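(* Let $K$ be a field and let $E$ be a row-finite directed graph (no vertex emits infinitely many edges). Let $C'$ be the set of all maximal cycles with finitely many predecessors, where each maximal cycle and all its rotations are counted as one. Up to isomorphism, all finite-dimensional simple $L_K(E)$-modules are: (i) $V_{[x]}$, where $x$ is a maximal sink with finitely many predecessors; (ii) $V^f_{[c^\infty]}$, where $f$ is a monic irreducible polynomial in $K[t]$, $f\ne t$, and $c\in C'$.
   Context: $E=(E^0,E^1,s,r)$ is a directed graph of arbitrary cardinality. A sink is a vertex emitting no edges. A finite path is $\mu=e_1\cdots e_n$ with $r(e_i)=s(e_{i+1})$, length $|\mu|=n$, $s(\mu)=s(e_1)$, $r(\mu)=r(e_n)$; vertices are paths of length $0$; $F(E)$ is the set of finite paths; infinite paths are sequences $e_1e_2\cdots$ with $r(e_i)=s(e_{i+1})$. A closed path is a path $\mu$ of positive length with $s(\mu)=r(\mu)$; a cycle is a closed path not passing through any of its vertices twice; the rotations of $e_1\cdots e_n$ are $e_{i+1}\cdots e_ne_1\cdots e_i$; $c^\infty=ccc\cdots$. The predecessors of a sink $v$, or of a cycle $c$ based at $v$, are the vertices $w$ such that there is a finite path from $w$ to $v$. A sink $v$ (resp. a cycle $c$) is maximal if there is no finite path from $s(c')$ to $v$ (resp. to $s(c)$) for any other cycle $c'$ (for a cycle $c$: other than $c$ and its rotations). $L_K(E)$ is the Leavitt path algebra: the $K$-algebra generated by $\{v,e,e^*\mid v\in E^0,e\in E^1\}$ with relations $vw=\delta_{v,w}v$; $s(e)e=e=er(e)$; $r(e)e^*=e^*=e^*s(e)$;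 $e^*f=\delta_{e,f}r(e)$; $v=\sum_{s(e)=v}ee^*$ for each $v$ emitting a nonzero finite number of edges. It is spanned by $\mu\nu^*$ ($r(\mu)=r(\nu)$). Modules are left and unital ($AM=M$). For a sink $x$, $[x]$ is the set of finite paths ending at $x$; for an infinite path $x$, $[x]$ is the set of infinite paths $y$ such that $x=\mu p$, $y=\nu p$ for some finite paths $\mu,\nu$ and an infinite path $p$. $V_{[x]}$ is the $K$-vector space with basis $[x]$ and action $(\mu\nu^* ).p=\mu p'$ if $p=\nu p'$, and $0$ otherwise. For $\mathbf a=(a_e)\in(K^* )^{E^1}$ let $\sigma_{\mathbf a}$ be the automorphism of $L_K(E)$ with $v\mapsto v$, $e\mapsto a_ee$, $e^*\mapsto a_e^{-1}e^*$; $V^{\mathbf a}_{[x]}$ is $V_{[x]}$ with action $(\eta,p)\mapsto\sigma_{\mathbf a}(\eta).p$. For a cycle $c=e_1\cdots e_n$ and a monic irreducible $f\in K[t]$, $f\neq t$, let $K'=K[t,t^{-1}]/(f)$ and let $\mathbf t\in(K'^* )^{E^1}$ have $\overline t$ in the $e_1$-coordinate and $1$ elsewhere; $V^f_{[c^\infty]}$ is the $L_{K'}(E)$-module $V^{\mathbf t}_{[c^\infty]}$ restricted to $L_K(E)$. *)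

(* Defs.v *)
From HB Require Import structures.
From mathcomp Require Import all_boot all_order all_algebra all_field.
From mathcomp Require Import boolp classical_sets cardinality.
From mathcomp Require Import finmap monalg.

Set Implicit Arguments.
Unset Strict Implicit.
Unset Printing Implicit Defensive.

Import GRing.Theory.
Local Open Scope ring_scope.

(** * Associative algebras without unit over a field, and their unital modules *)

(* [L_K(E)] has no unit when [E] has infinitely many vertices, so MathComp's
   (unital) algebras do not apply. *)
HB.mixin Record Lmodule_isNUAlgebra (K : fieldType) A of GRing.Lmodule K A := {
  nmul : A -> A -> A;
  nmulA : associative nmul;
  nmulDl : left_distributive nmul +%R;
  nmulDr : right_distributive nmul +%R;
  nscaleAl : forall (k : K) (a b : A), k *: nmul a b = nmul (k *: a) b;
  nscaleAr : forall (k : K) (a b : A), k *: nmul a b = nmul a (k *: b)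
}.

#[short(type="nualgType")]
HB.structure Definition NUAlgebra (K : fieldType) :=
  { A of Lmodule_isNUAlgebra K A & GRing.Lmodule K A }.

(* [act_unital] is the condition [A M = M]. *)
Record numodule (K : fieldType) (A : nualgType K) := NUModule {
  carrier :> lmodType K;
  mact : A -> carrier -> carrier;
  actDl : forall a b m, mact (a + b) m = mact a m + mact b m;
  actDr : forall a m n, mact a (m + n) = mact a m + mact a n;
  actZl : forall k a m, mact (k *: a) m = k *: mact a m;
  actZr : forall k a m, mact a (k *: m) = k *: mact a m;
  actM : forall a b m, mact (nmul a b) m = mact a (mact b m);
  act_unital : forall m, exists s : seq (A * carrier),
    m = \sum_(x <- s) mact x.1 x.2
}.

Section NUModuleTheory.
Variables (K : fieldType) (A : nualgType K).
Implicit Types M N : numodule A.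

Definition submodule M (S : set M) : Prop :=
  [/\ S 0, (forall m n, S m -> S n -> S (m + n)),
      (forall (k : K) m, S m -> S (k *: m)) &
      (forall (a : A) m, S m -> S (mact a m))].

Definition simple_module M : Prop :=
  (exists m : M, m <> 0) /\
  (forall S : set M, submodule S -> S = [set 0]%classic \/ S = setT).

Definition finite_dimensional M : Prop :=
  exists n : nat, inhabited (Vector.axiom n M).

Definition module_iso M N : Prop :=
  exists phi : {linear M -> N},
    bijective phi /\ (forall (a : A) (m : M), phi (mact a m) = mact a (phi m)).

End NUModuleTheory.

(** * Directed graphs and paths *)

Record graph := Graph {
  vertex : Type;
  edge : Type;
  src : edge -> vertex;
  rng : edge -> vertex
}.
Arguments src {g} _.
Arguments rng {g} _.

HB.instance Definition _ (E : graph) := gen_eqMixin (vertex E).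
HB.instance Definition _ (E : graph) := gen_choiceMixin (vertex E).
HB.instance Definition _ (E : graph) := gen_eqMixin (edge E).
HB.instance Definition _ (E : graph) := gen_choiceMixin (edge E).

Section Paths.
Variable E : graph.
Local Notation E0 := (vertex E).
Local Notation E1 := (edge E).

Definition row_finite : Prop :=
  forall v : E0, finite_set [set e : E1 | src e = v]%classic.

Definition is_sink (v : E0) : Prop := forall e : E1, src e <> v.

Fixpoint is_walk (v : E0) (l : seq E1) : bool :=
  if l is e :: l' then (src e == v) && is_walk (rng e) l' else true.

Definition walk_end (v : E0) (l : seq E1) : E0 := last v (map rng l).

(* The base vertex is recorded so that vertices are the paths of length 0. *)
Record fpath := FPath {
  psource : E0;
  pedges : seq E1;
  pedgesP : is_walk psource pedges
}.
Definition prange (mu : fpath) : E0 := walk_end (psource mu) (pedges mu).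

Record ipath := IPath {
  iedge :> nat -> E1;
  iedgeP : forall n, rng (iedge n) = src (iedge n.+1)
}.

Definition reaches (w v : E0) : Prop :=
  exists mu : fpath, psource mu = w /\ prange mu = v.

Definition predecessors (v : E0) : set E0 := [set w | reaches w v]%classic.

Definition finitely_many_predecessors (v : E0) : Prop :=
  finite_set (predecessors v).

Record gcycle := Cycle {
  first_edge : E1;
  other_edges : seq E1;
  cycle_walk : is_walk (src first_edge) (first_edge :: other_edges);
  cycle_closed :
    walk_end (src first_edge) (first_edge :: other_edges) = src first_edge;
  cycle_uniq : uniq (map src (first_edge :: other_edges))
}.
Definition cycle_edges (c : gcycle) : seq E1 := first_edge c :: other_edges c.
Definition cycle_base (c : gcycle) : E0 := src (first_edge c).

(* [c'] is [c] or one of its rotations. *)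
Definition rotation_of (c c' : gcycle) : Prop :=
  exists i : nat, cycle_edges c' = rot i (cycle_edges c).

Record sink := Sink { sink_vertex :> E0; sinkP : is_sink sink_vertex }.

Definition maximal_sink (x : sink) : Prop :=
  forall c' : gcycle, ~ reaches (cycle_base c') x.

Definition maximal_cycle (c : gcycle) : Prop :=
  forall c' : gcycle, ~ rotation_of c c' -> ~ reaches (cycle_base c') (cycle_base c).

(* Finite and infinite words of edges; [FinPath v l] also records the start
   [v] of the word [l].  The path condition is imposed by the classes [[x]]. *)
Inductive anypath :=
  | FinPath of E0 & seq E1
  | InfPath of (nat -> E1).

Definition asource (p : anypath) : E0 :=
  match p with FinPath v _ => v | InfPath f => src (f 0%N) end.

Definition pcons (e : E1) (p : anypath) : anypath :=
  match p with
  | FinPath _ l => FinPath (src e) (e :: l)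
  | InfPath f => InfPath (fun n => if n is n'.+1 then f n' else e)
  end.

Definition pcat (mu : fpath) (p : anypath) : anypath := foldr pcons p (pedges mu).

(* [p = mu p'], where concatenation requires [r(mu) = s(p')]. *)
Definition factors (mu : fpath) (p' p : anypath) : Prop :=
  prange mu = asource p' /\ p = pcat mu p'.

(* The first edge and the remainder of a path of positive length. *)
Definition pfirst (p : anypath) : option E1 :=
  match p with FinPath _ l => ohead l | InfPath f => Some (f 0%N) end.

Definition ptail (p : anypath) : anypath :=
  match p with
  | FinPath v [::] => FinPath v [::]
  | FinPath _ (e :: l) => FinPath (rng e) l
  | InfPath f => InfPath (fun n => f n.+1)
  end.

Definition of_ipath (y : ipath) : anypath := InfPath y.
Definition of_fpath (mu : fpath) : anypath := FinPath (psource mu) (pedges mu).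

Definition sink_class (x : sink) : set anypath :=
  [set p | exists mu : fpath, p = of_fpath mu /\ prange mu = x]%classic.

Definition inf_class (x : ipath) : set anypath :=
  [set q | exists y : ipath, q = of_ipath y /\
     exists (mu nu : fpath) (p : ipath),
       factors mu (of_ipath p) (of_ipath x) /\
       factors nu (of_ipath p) (of_ipath y)]%classic.

(* The property of the classes [[x]] that makes them bases of Leavitt path
   algebra modules: edges can be prefixed and removed, and a path from which
   none can be removed is a sink. *)
Definition path_closed (C : set anypath) : Prop :=
  (forall e p, C p -> asource p = rng e -> C (pcons e p)) /\
  (forall p, C p ->
     (exists e p', [/\ p = pcons e p', asource p' = rng e & C p']) \/
     (exists v, p = FinPath v [::] /\ is_sink v)).

Lemma asource_pcons e p : asource (pcons e p) = src e.
Proof. by case: p. Qed.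

Lemma pfirst_pcons e p : pfirst (pcons e p) = Some e.
Proof. by case: p. Qed.

Lemma ptail_pcons e p : asource p = rng e -> ptail (pcons e p) = p.
Proof. by case: p => //= v l <-. Qed.

Lemma sink_class_closed x : path_closed (sink_class x).
Proof.
split.
  move=> e p [mu [-> mux]] /= se.
  have w : is_walk (src e) (e :: pedges mu).
    by rewrite /= eqxx -se; exact: pedgesP.
  exists (FPath w); split=> //.
  by rewrite /prange /walk_end /= -se.
move=> p [[v l wl] [-> /=]]; rewrite /prange /walk_end /=.
case: l wl => [|e l] wl /= lx.
  by right; exists v; split => //; rewrite lx => e; exact: sinkP.
have /andP[/eqP sv w] : (src e == v) && is_walk (rng e) l := wl.
left; exists e, (FinPath (rng e) l); split => //=; first by rewrite sv.
by exists (FPath w).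
Qed.

Lemma inf_class_closed x : path_closed (inf_class x).
Proof.
split.
  move=> e q [y [-> [mu [nu [p [mup [nus nuy]]]]]]] /= se.
  have ok n : rng (if n is n'.+1 then y n' else e) = src (y n).
    by case: n => [|n]; [rewrite -se | exact: iedgeP].
  exists (@IPath (fun n => if n is n'.+1 then y n' else e) ok); split => //.
  have sn : psource nu = rng e.
    rewrite -se; case: nu nus nuy => v [|f l] w /=.
      by rewrite /prange /walk_end /= => -> /(congr1 asource) /=.
    move=> _ /(congr1 asource) /=.
    by rewrite asource_pcons => ->; have /andP[/eqP] := w.
  have w : is_walk (src e) (e :: pedges nu).
    by rewrite /= eqxx -sn pedgesP.
  exists mu, (FPath w), p; split => //; split.
    by rewrite -nus /prange /walk_end /= sn.
  by rewrite /pcat /= -/(pcat nu _) -nuy.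
move=> q [y [-> [mu [nu [p [[mus mux] [nus nuy]]]]]]]; left.
have ok n : rng (y n.+1) = src (y n.+2) by exact: iedgeP.
exists (y 0%N), (of_ipath (@IPath (fun n => y n.+1) ok)); split.
- by congr InfPath; apply/funext => -[].
- by rewrite /= iedgeP.
exists (@IPath (fun n => y n.+1) ok); split => //.
case: nu nus nuy => v [|f l] w nus nuy.
  have okp n : rng (p n.+1) = src (p n.+2) by exact: iedgeP.
  have yp n : y n = p n by move: nuy => [->].
  have wm : is_walk (psource mu) (rcons (pedges mu) (p 0%N)).
    move: mus; rewrite /prange /walk_end; move: (pedgesP mu).
    elim: (pedges mu) (psource mu) => [|g m IH] u /=.
      by move=> _ ->; rewrite eqxx.
    by move=> /andP[-> /IH].
  have wn : is_walk (rng (p 0%N)) [::] by [].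
  exists (FPath wm), (FPath wn), (@IPath (fun n => p n.+1) okp); split; split.
  - by rewrite /prange /walk_end /= map_rcons last_rcons /= iedgeP.
  - rewrite mux /pcat /= foldr_rcons /=; congr foldr.
    by congr InfPath; apply/funext => -[].
  - by rewrite /prange /walk_end /= iedgeP.
  - by rewrite /pcat /of_ipath /=; congr InfPath; apply/funext => n; exact: yp.
have /andP[_ wl] : (src f == v) && is_walk (rng f) l := w.
exists mu, (FPath wl), p; split => //; split.
  by rewrite -nus /prange /walk_end.
have H : of_ipath y = pcons f (pcat (FPath wl) (of_ipath p)) by [].
by have := congr1 ptail H; case: (pcat _ _) H => //= g [->] _.
Qed.

Lemma cycle_inf_subproof (c : gcycle) n :
  let f k := nth (first_edge c) (cycle_edges c) (k %% size (cycle_edges c)) in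
  rng (f n) = src (f n.+1).
Proof.
case: c => e l wk cl un; rewrite /cycle_edges; cbn zeta.
rewrite [first_edge _]/= [other_edges _]/=.
have step k v m : is_walk v m -> (k.+1 < size m)%N ->
    rng (nth e m k) = src (nth e m k.+1).
  elim: m v k => //= g m IH v [|k] /andP[_ w].
    by case: m w {IH} => //= h m /andP[/eqP -> _].
  by move=> km; exact: (IH (rng g)).
set m := e :: l; have m0 : (0 < size m)%N by [].
have lt := ltn_pmod n m0; rewrite -addn1 -modnDml addn1.
case: (ltnP (n %% size m).+1 (size m)) => [lt'|ge].
  by rewrite (modn_small lt'); exact: (step _ (src e)).
have -> : (n %% size m).+1 = size m by apply/eqP; rewrite eqn_leq lt ge.
rewrite modnn /= -cl /walk_end -nth_last size_map.
rewrite (nth_map e); last by rewrite prednK.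
by congr (rng (nth _ _ _)); apply/eqP; rewrite -eqSS prednK // eqn_leq lt ge.
Qed.

Definition cycle_inf (c : gcycle) : ipath := IPath (cycle_inf_subproof c).

End Paths.

(** * Leavitt path algebras *)

Inductive lpa_gen (E : graph) :=
  | Vtx of vertex E
  | Edg of edge E
  | Gst of edge E.
Arguments Vtx {E} _.
Arguments Edg {E} _.
Arguments Gst {E} _.

Section LeavittPathAlgebra.
Variables (K : fieldType) (E : graph).

(* [L_K(E)] is presented by generators and relations: formal expressions in
   the generators modulo the least congruence that contains the axioms of
   associative (non-unital) [K]-algebras and the defining relations. *)
Inductive lpa_term :=
  | TZero
  | TGen of lpa_gen E
  | TAdd of lpa_term & lpa_term
  | TScale of K & lpa_term
  | TMul of lpa_term & lpa_term.

Local Notation V v := (TGen (Vtx v)).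
Local Notation Ed e := (TGen (Edg e)).
Local Notation Gh e := (TGen (Gst e)).

Definition ck2_sum (l : seq (edge E)) : lpa_term :=
  foldr (fun e t => TAdd (TMul (Ed e) (Gh e)) t) TZero l.

Inductive lpa_eq : lpa_term -> lpa_term -> Prop :=
  | cg_refl t : lpa_eq t t
  | cg_sym t u : lpa_eq t u -> lpa_eq u t
  | cg_trans t u w : lpa_eq t u -> lpa_eq u w -> lpa_eq t w
  | cg_add t t' u u' : lpa_eq t t' -> lpa_eq u u' -> lpa_eq (TAdd t u) (TAdd t' u')
  | cg_scale k t t' : lpa_eq t t' -> lpa_eq (TScale k t) (TScale k t')
  | cg_mul t t' u u' : lpa_eq t t' -> lpa_eq u u' -> lpa_eq (TMul t u) (TMul t' u')
  | cg_addA t u w : lpa_eq (TAdd t (TAdd u w)) (TAdd (TAdd t u) w)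
  | cg_addC t u : lpa_eq (TAdd t u) (TAdd u t)
  | cg_add0 t : lpa_eq (TAdd TZero t) t
  | cg_addN t : lpa_eq (TAdd (TScale (-1) t) t) TZero
  | cg_scaleA k h t : lpa_eq (TScale k (TScale h t)) (TScale (k * h) t)
  | cg_scale1 t : lpa_eq (TScale 1 t) t
  | cg_scaleDr k t u : lpa_eq (TScale k (TAdd t u)) (TAdd (TScale k t) (TScale k u))
  | cg_scaleDl k h t : lpa_eq (TScale (k + h) t) (TAdd (TScale k t) (TScale h t))
  | cg_mulA t u w : lpa_eq (TMul t (TMul u w)) (TMul (TMul t u) w)
  | cg_mulDl t u w : lpa_eq (TMul (TAdd t u) w) (TAdd (TMul t w) (TMul u w))
  | cg_mulDr t u w : lpa_eq (TMul t (TAdd u w)) (TAdd (TMul t u) (TMul t w))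
  | cg_scaleAl k t u : lpa_eq (TScale k (TMul t u)) (TMul (TScale k t) u)
  | cg_scaleAr k t u : lpa_eq (TScale k (TMul t u)) (TMul t (TScale k u))
  | rel_vv v : lpa_eq (TMul (V v) (V v)) (V v)
  | rel_vw v w : v <> w -> lpa_eq (TMul (V v) (V w)) TZero
  | rel_se e : lpa_eq (TMul (V (src e)) (Ed e)) (Ed e)
  | rel_er e : lpa_eq (TMul (Ed e) (V (rng e))) (Ed e)
  | rel_rg e : lpa_eq (TMul (V (rng e)) (Gh e)) (Gh e)
  | rel_gs e : lpa_eq (TMul (Gh e) (V (src e))) (Gh e)
  | rel_ck1 e : lpa_eq (TMul (Gh e) (Ed e)) (V (rng e))
  | rel_ck1' e f : e <> f -> lpa_eq (TMul (Gh e) (Ed f)) TZero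
  (* [l] enumerates the nonzero finite number of edges emitted by [v]. *)
  | rel_ck2 v l : uniq l -> l <> [::] -> (forall e, e \in l <-> src e = v) ->
      lpa_eq (V v) (ck2_sum l).

HB.instance Definition _ := gen_eqMixin lpa_term.
HB.instance Definition _ := gen_choiceMixin lpa_term.

Definition lpa_eqb : rel lpa_term := fun t u => `[< lpa_eq t u >].

Lemma lpa_eqb_equiv : equiv_class_of lpa_eqb.
Proof.
split=> [t|t u|u t w].
- by apply/asboolP/cg_refl.
- by apply/asboolP/asboolP; exact: cg_sym.
- by move=> /asboolP tu /asboolP uw; apply/asboolP; exact: cg_trans uw.
Qed.

Canonical lpa_equiv := EquivRelPack lpa_eqb_equiv.

Definition lpa := {eq_quot lpa_equiv}%qT.

HB.instance Definition _ := Choice.on lpa.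

Definition lpa_class (t : lpa_term) : lpa := (\pi_lpa t)%qT.

Lemma lpa_classP t u : lpa_class t = lpa_class u <-> lpa_eq t u.
Proof. by split=> [/eqmodP/asboolP//|h]; apply/eqmodP/asboolP. Qed.

Lemma lpa_classK a : lpa_class (repr a) = a.
Proof. exact: reprK. Qed.

Lemma lpa_repr t : lpa_eq (repr (lpa_class t)) t.
Proof. by apply/lpa_classP; rewrite lpa_classK. Qed.

Lemma lpa_ind (P : lpa -> Prop) : (forall t, P (lpa_class t)) -> forall a, P a.
Proof. by move=> H a; rewrite -[a]lpa_classK. Qed.

Definition lpa_zero : lpa := lpa_class TZero.
Definition lpa_add (a b : lpa) : lpa := lpa_class (TAdd (repr a) (repr b)).
Definition lpa_scale (k : K) (a : lpa) : lpa := lpa_class (TScale k (repr a)).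
Definition lpa_opp : lpa -> lpa := lpa_scale (-1).
Definition lpa_mul (a b : lpa) : lpa := lpa_class (TMul (repr a) (repr b)).

Lemma lpa_addE t u : lpa_add (lpa_class t) (lpa_class u) = lpa_class (TAdd t u).
Proof. by apply/lpa_classP/cg_add; exact: lpa_repr. Qed.
Lemma lpa_scaleE k t : lpa_scale k (lpa_class t) = lpa_class (TScale k t).
Proof. by apply/lpa_classP/cg_scale; exact: lpa_repr. Qed.
Lemma lpa_mulE t u : lpa_mul (lpa_class t) (lpa_class u) = lpa_class (TMul t u).
Proof. by apply/lpa_classP/cg_mul; exact: lpa_repr. Qed.

Fact lpa_addA : associative lpa_add.
Proof.
elim/lpa_ind=> t; elim/lpa_ind=> u; elim/lpa_ind=> w.
by rewrite !lpa_addE; apply/lpa_classP/cg_addA.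
Qed.
Fact lpa_addC : commutative lpa_add.
Proof.
elim/lpa_ind=> t; elim/lpa_ind=> u.
by rewrite !lpa_addE; apply/lpa_classP/cg_addC.
Qed.
Fact lpa_add0 : left_id lpa_zero lpa_add.
Proof. by elim/lpa_ind=> t; rewrite lpa_addE; apply/lpa_classP/cg_add0. Qed.
Fact lpa_addN : left_inverse lpa_zero lpa_opp lpa_add.
Proof.
elim/lpa_ind=> t; rewrite /lpa_opp lpa_scaleE lpa_addE.
exact/lpa_classP/cg_addN.
Qed.

HB.instance Definition _ :=
  GRing.isZmodule.Build lpa lpa_addA lpa_addC lpa_add0 lpa_addN.

Lemma lpaDE t u : lpa_class t + lpa_class u = lpa_class (TAdd t u).
Proof. exact: lpa_addE. Qed.

Fact lpa_scaleA k h a : lpa_scale k (lpa_scale h a) = lpa_scale (k * h) a.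
Proof.
by elim/lpa_ind: a => t; rewrite !lpa_scaleE; apply/lpa_classP/cg_scaleA.
Qed.
Fact lpa_scale1 : left_id 1 lpa_scale.
Proof. by elim/lpa_ind=> t; rewrite lpa_scaleE; apply/lpa_classP/cg_scale1. Qed.
Fact lpa_scaleDr : right_distributive lpa_scale +%R.
Proof.
move=> k; elim/lpa_ind=> t; elim/lpa_ind=> u.
rewrite lpaDE !lpa_scaleE lpaDE; exact/lpa_classP/cg_scaleDr.
Qed.
Fact lpa_scaleDl a : {morph lpa_scale^~ a : k h / k + h}.
Proof.
move=> k h; elim/lpa_ind: a => t; rewrite !lpa_scaleE lpaDE.
exact/lpa_classP/cg_scaleDl.
Qed.

HB.instance Definition _ := GRing.Zmodule_isLmodule.Build K lpa
  lpa_scaleA lpa_scale1 lpa_scaleDr lpa_scaleDl.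

Lemma lpaZE k t : k *: lpa_class t = lpa_class (TScale k t).
Proof. exact: lpa_scaleE. Qed.

Fact lpa_mulA : associative lpa_mul.
Proof.
elim/lpa_ind=> t; elim/lpa_ind=> u; elim/lpa_ind=> w.
by rewrite !lpa_mulE; apply/lpa_classP/cg_mulA.
Qed.
Fact lpa_mulDl : left_distributive lpa_mul +%R.
Proof.
elim/lpa_ind=> t; elim/lpa_ind=> u; elim/lpa_ind=> w.
rewrite lpaDE !lpa_mulE lpaDE; exact/lpa_classP/cg_mulDl.
Qed.
Fact lpa_mulDr : right_distributive lpa_mul +%R.
Proof.
elim/lpa_ind=> t; elim/lpa_ind=> u; elim/lpa_ind=> w.
rewrite lpaDE !lpa_mulE lpaDE; exact/lpa_classP/cg_mulDr.
Qed.
Fact lpa_scaleAl (k : K) (a b : lpa) : k *: lpa_mul a b = lpa_mul (k *: a) b.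
Proof.
elim/lpa_ind: a => t; elim/lpa_ind: b => u.
rewrite (lpaZE k t) !lpa_mulE lpaZE.
exact/lpa_classP/cg_scaleAl.
Qed.
Fact lpa_scaleAr (k : K) (a b : lpa) : k *: lpa_mul a b = lpa_mul a (k *: b).
Proof.
elim/lpa_ind: a => t; elim/lpa_ind: b => u.
rewrite (lpaZE k u) !lpa_mulE lpaZE.
exact/lpa_classP/cg_scaleAr.
Qed.

HB.instance Definition _ := Lmodule_isNUAlgebra.Build K lpa
  lpa_mulA lpa_mulDl lpa_mulDr lpa_scaleAl lpa_scaleAr.

Lemma lpaME t u : nmul (lpa_class t) (lpa_class u) = lpa_class (TMul t u).
Proof. exact: lpa_mulE. Qed.

Definition lpa_of (g : lpa_gen E) : lpa := lpa_class (TGen g).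

(* The elements [mu] and [nu^*] of [L_K(E)]. *)
Definition lpa_path (mu : fpath E) : lpa :=
  foldl (fun a e => nmul a (lpa_of (Edg e))) (lpa_of (Vtx (psource mu))) (pedges mu).
Definition lpa_ghost (nu : fpath E) : lpa :=
  foldl (fun a e => nmul (lpa_of (Gst e)) a) (lpa_of (Vtx (psource nu))) (pedges nu).

End LeavittPathAlgebra.

(** * Base change and gauge automorphisms *)

Section LpaTwist.
Variables (K K' : fieldType) (E : graph) (iota : {rmorphism K -> K'}).
Variable a : edge E -> K'.

Definition twist_gen (g : lpa_gen E) : lpa_term K' E :=
  match g with
  | Vtx v => TGen K' (Vtx v)
  | Edg e => TScale (a e) (TGen K' (Edg e))
  | Gst e => TScale (a e)^-1 (TGen K' (Gst e))
  end.

Fixpoint twist_term (t : lpa_term K E) : lpa_term K' E :=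
  match t with
  | TZero => TZero K' E
  | TGen g => twist_gen g
  | TAdd t u => TAdd (twist_term t) (twist_term u)
  | TScale k t => TScale (iota k) (twist_term t)
  | TMul t u => TMul (twist_term t) (twist_term u)
  end.

(* The map [L_K(E) -> L_K'(E)], semilinear along [iota], with [v |-> v],
   [e |-> a_e e] and [e^* |-> a_e^-1 e^*]. *)
Definition lpa_twist (x : lpa K E) : lpa K' E := lpa_class (twist_term (repr x)).

Hypothesis ha : forall e, a e != 0.

Lemma twist_term_eq t u : lpa_eq t u -> lpa_eq (twist_term t) (twist_term u).
Proof.
have slide (k h : K') t1 u1 : lpa_eq (TMul (TScale k t1) (TScale h u1))
    (TScale (k * h) (TMul t1 u1) : lpa_term K' E).
  apply: cg_trans (cg_sym (cg_scaleAl _ _ _)) _.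
  apply: cg_trans (cg_scale _ (cg_sym (cg_scaleAr _ _ _))) _.
  exact: cg_scaleA.
have cong_scale0 (k : K') : lpa_eq (TScale k (TZero K' E)) (TZero K' E).
  by apply/lpa_classP; rewrite -lpaZE; exact: scaler0.
elim=> {t u} /=.
- by move=> t; exact: cg_refl.
- by move=> t u _; exact: cg_sym.
- by move=> t u w _ h _; exact: cg_trans h.
- by move=> t t' u u' _ h _; exact: cg_add.
- by move=> k t t' _; exact: cg_scale.
- by move=> t t' u u' _ h _; exact: cg_mul.
- by move=> t u w; exact: cg_addA.
- by move=> t u; exact: cg_addC.
- by move=> t; exact: cg_add0.
- by move=> t; rewrite rmorphN1; exact: cg_addN.
- by move=> k h t; rewrite rmorphM; exact: cg_scaleA.
- by move=> t; rewrite rmorph1; exact: cg_scale1.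
- by move=> k t u; exact: cg_scaleDr.
- by move=> k h t; rewrite rmorphD; exact: cg_scaleDl.
- by move=> t u w; exact: cg_mulA.
- by move=> t u w; exact: cg_mulDl.
- by move=> t u w; exact: cg_mulDr.
- by move=> k t u; exact: cg_scaleAl.
- by move=> k t u; exact: cg_scaleAr.
- by move=> v; exact: rel_vv.
- by move=> v w; exact: rel_vw.
- by move=> e; apply: cg_trans (cg_sym (cg_scaleAr _ _ _)) _; apply/cg_scale/rel_se.
- by move=> e; apply: cg_trans (cg_sym (cg_scaleAl _ _ _)) _; apply/cg_scale/rel_er.
- by move=> e; apply: cg_trans (cg_sym (cg_scaleAr _ _ _)) _; apply/cg_scale/rel_rg.
- by move=> e; apply: cg_trans (cg_sym (cg_scaleAl _ _ _)) _; apply/cg_scale/rel_gs.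
- move=> e; apply: cg_trans (slide _ _ _ _) _; rewrite mulVf //.
  by apply: cg_trans (cg_scale1 _) _; exact: rel_ck1.
- move=> e f ef; apply: cg_trans (slide _ _ _ _) _.
  by apply: cg_trans (cg_scale _ (rel_ck1' _ ef)) _; exact: cong_scale0.
- move=> v l ul l0 lv; apply: cg_trans (rel_ck2 K' ul l0 lv) _.
  elim: l {ul l0 lv} => [|e l IH] /=; first exact: cg_refl.
  apply: cg_add IH; apply: cg_sym; apply: cg_trans (slide _ _ _ _) _.
  by rewrite mulfV //; exact: cg_scale1.
Qed.

Lemma lpa_twist_class t : lpa_twist (lpa_class t) = lpa_class (twist_term t).
Proof. by apply/lpa_classP/twist_term_eq/lpa_repr. Qed.

Lemma lpa_twistD x y : lpa_twist (x + y) = lpa_twist x + lpa_twist y.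
Proof.
elim/lpa_ind: x => t; elim/lpa_ind: y => u.
by rewrite lpaDE !lpa_twist_class lpaDE.
Qed.

Lemma lpa_twistZ k x : lpa_twist (k *: x) = iota k *: lpa_twist x.
Proof.
elim/lpa_ind: x => t.
by rewrite lpaZE !lpa_twist_class lpaZE.
Qed.

Lemma lpa_twistM x y : lpa_twist (nmul x y) = nmul (lpa_twist x) (lpa_twist y).
Proof.
elim/lpa_ind: x => t; elim/lpa_ind: y => u.
by rewrite lpaME !lpa_twist_class lpaME.
Qed.

Lemma lpa_twist_vertex v : lpa_twist (lpa_of K (Vtx v)) = lpa_of K' (Vtx v).
Proof. exact: lpa_twist_class. Qed.
Lemma lpa_twist_edge e : lpa_twist (lpa_of K (Edg e)) = a e *: lpa_of K' (Edg e).
Proof. by rewrite lpa_twist_class lpaZE. Qed.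
Lemma lpa_twist_ghost e :
  lpa_twist (lpa_of K (Gst e)) = (a e)^-1 *: lpa_of K' (Gst e).
Proof. by rewrite lpa_twist_class lpaZE. Qed.

End LpaTwist.

(* The automorphism [sigma_a] of [L_K(E)]. *)
Definition gauge (K : fieldType) (E : graph) (a : edge E -> K) :
  lpa K E -> lpa K E := lpa_twist idfun a.

(* The canonical map [L_K(E) -> L_K'(E)]. *)
Definition base_change (K K' : fieldType) (E : graph) (iota : {rmorphism K -> K'}) :
  lpa K E -> lpa K' E := lpa_twist iota (fun=> 1).

(** * The modules attached to sinks and to cycles *)

HB.instance Definition _ (E : graph) := gen_eqMixin (anypath E).
HB.instance Definition _ (E : graph) := gen_choiceMixin (anypath E).

Local Arguments mact : simpl never.

Section ChenModule.
Variables (K : fieldType) (E : graph) (C : set (anypath E)).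

Definition path_basis := {p : anypath E | `[< C p >]}.
Definition path_space : lmodType K := {malg K[path_basis]}.

(* The basis vector [p] when [p] is in the class, and [0] otherwise. *)
Definition bvec (p : anypath E) : path_space :=
  if insub p is Some b then << (b : path_basis) >> else 0.

Definition lin_ext (F : path_basis -> path_space) (g : path_space) : path_space :=
  \sum_(b <- msupp (g : {malg K[path_basis]}))
     (g : {malg K[path_basis]})@_b *: F b.

(* The actions of [v], [e] and [e^*] on a basis path. *)
Definition gen_act_path (g : lpa_gen E) (p : anypath E) : path_space :=
  match g with
  | Vtx v => if asource p == v then bvec p else 0
  | Edg e => if asource p == rng e then bvec (pcons e p) else 0
  | Gst e => if pfirst p == Some e then bvec (ptail p) else 0
  end.

Definition gen_act (g : lpa_gen E) : path_space -> path_space :=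
  lin_ext (fun b => gen_act_path g (val b)).

Fixpoint term_act (t : lpa_term K E) (m : path_space) : path_space :=
  match t with
  | TZero => 0
  | TGen g => gen_act g m
  | TAdd t u => term_act t m + term_act u m
  | TScale k t => k *: term_act t m
  | TMul t u => term_act t (term_act u m)
  end.

Lemma lin_extEw (F : path_basis -> path_space) (d : {fset path_basis})
    (g : {malg K[path_basis]}) :
  (msupp g `<=` d)%fset -> lin_ext F g = \sum_(b <- d) g@_b *: F b.
Proof.
move=> le; rewrite /lin_ext; apply: (big_fset_incl _ le) => b _ /mcoeff_outdom ->.
by rewrite scale0r.
Qed.

Lemma lin_ext_is_linear F : linear (lin_ext F).
Proof.
move=> k g h.
pose d := (msupp (g : {malg K[path_basis]}) `|` msupp (h : {malg K[path_basis]}))%fset.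
rewrite (@lin_extEw F d); last first.
  apply: fsubset_trans (msuppD_le _ _) _; apply: fsetSU; exact: msuppZ_le.
rewrite (@lin_extEw F d g) ?fsubsetUl // (@lin_extEw F d h) ?fsubsetUr //.
rewrite scaler_sumr -big_split /=; apply: eq_bigr => b _.
by rewrite mcoeffD mcoeffZ scalerDl scalerA.
Qed.

Lemma lin_extU F b : lin_ext F << b >> = F b.
Proof.
rewrite (@lin_extEw F [fset b]%fset) ?msuppU_le // big_seq_fset1.
by rewrite mcoeffUU scale1r.
Qed.

HB.instance Definition _ F := GRing.isLinear.Build K path_space path_space _ (lin_ext F)
  (lin_ext_is_linear F).
HB.instance Definition _ g := GRing.Linear.on (gen_act g).

Lemma term_act_is_linear t : linear (term_act t).
Proof.
elim: t => [|g|t IHt u IHu|h t IHt|t IHt u IHu] k m n /=.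
- by rewrite scaler0 addr0.
- exact: linearP.
- by rewrite IHt IHu scalerDr addrACA.
- by rewrite IHt scalerDr !scalerA mulrC.
- by rewrite IHu IHt.
Qed.

HB.instance Definition _ t :=
  GRing.isLinear.Build K path_space path_space _ (term_act t) (term_act_is_linear t).

Lemma bvecE p (Cp : `[< C p >]) : bvec p = << (exist _ p Cp : path_basis) >>.
Proof.
rewrite /bvec insubT /=.
by congr (<< _ >>); apply: val_inj.
Qed.

Lemma gen_act_bvec g p : C p -> gen_act g (bvec p) = gen_act_path g p.
Proof. by move=> /asboolP Cp; rewrite bvecE /gen_act lin_extU. Qed.

Lemma path_space_ext (f h : {linear path_space -> path_space}) :
  (forall p, C p -> f (bvec p) = h (bvec p)) -> f =1 h.
Proof.
move=> fh m; rewrite [m]monalgE !linear_sum; apply: eq_bigr => -[p Cp] _.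
have -> : << (m : {malg K[path_basis]})@_(exist _ p Cp)
    *g (exist _ p Cp : path_basis) >> =
    (m : {malg K[path_basis]})@_(exist _ p Cp) *: bvec p :> path_space.
  apply/malgP => b; rewrite (bvecE Cp) mcoeffZ !mcoeffU.
  by case: eqP => _; rewrite ?mulr1n ?mulr1 ?mulr0n ?mulr0.
by rewrite !linearZ fh //; apply/asboolP.
Qed.

Hypothesis hC : path_closed C.

Lemma term_act_eq t u : lpa_eq t u -> term_act t =1 term_act u.
Proof.
have ext (t1 t2 : lpa_term K E) :
    (forall p, C p -> term_act t1 (bvec p) = term_act t2 (bvec p)) ->
    term_act t1 =1 term_act t2 by exact: path_space_ext.
have consC e p : C p -> asource p = rng e -> C (pcons e p) by apply: hC.1.
have tailC e p : C p -> pfirst p = Some e ->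
    [/\ p = pcons e (ptail p), C (ptail p) & asource (ptail p) = rng e].
  move=> /hC.2[[f [p' [-> sp' Cp']]]|[v [-> _]]] //.
  by rewrite pfirst_pcons (ptail_pcons sp') => -[<-].
elim=> {t u}.
- by [].
- by move=> t u _ h m; rewrite h.
- by move=> t u w _ h _ h' m; rewrite h h'.
- by move=> t t' u u' _ h _ h' m /=; rewrite h h'.
- by move=> k t t' _ h m /=; rewrite h.
- by move=> t t' u u' _ h _ h' m /=; rewrite h h'.
- by move=> t u w m /=; rewrite addrA.
- by move=> t u m /=; rewrite addrC.
- by move=> t m /=; rewrite add0r.
- by move=> t m /=; rewrite scaleN1r addNr.
- by move=> k h t m /=; rewrite scalerA.
- by move=> t m /=; rewrite scale1r.
- by move=> k t u m /=; rewrite scalerDr.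
- by move=> k h t m /=; rewrite scalerDl.
- by [].
- by [].
- by move=> t u w m /=; rewrite linearD.
- by [].
- by move=> k t u m /=; rewrite linearZ.
- move=> v; apply: ext => p Cp /=; rewrite gen_act_bvec //=.
  by case: ifP => [sp|_]; rewrite ?linear0 // gen_act_bvec //= sp.
- move=> v w vw; apply: ext => p Cp /=; rewrite gen_act_bvec //=.
  case: eqP => [sp|_]; rewrite ?linear0 // gen_act_bvec //= sp.
  by case: eqP => // wv; case: vw.
- move=> e; apply: ext => p Cp /=; rewrite gen_act_bvec //=.
  case: eqP => [sp|_]; rewrite ?linear0 // gen_act_bvec /=; last exact: consC.
  by rewrite asource_pcons eqxx.
- move=> e; apply: ext => p Cp /=; rewrite !gen_act_bvec //=.
  by case: ifP => sp; rewrite ?linear0 // gen_act_bvec //= sp.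
- move=> e; apply: ext => p Cp /=; rewrite gen_act_bvec //=.
  case: eqP => [fp|_]; rewrite ?linear0 //; have [_ Ct st] := tailC _ _ Cp fp.
  by rewrite gen_act_bvec //= st eqxx.
- move=> e; apply: ext => p Cp /=; rewrite !gen_act_bvec //=.
  case: eqP => [sp|sp]; first by rewrite gen_act_bvec.
  rewrite linear0; case: eqP => // fp; have [pE _ _] := tailC _ _ Cp fp.
  by case: sp; rewrite pE asource_pcons.
- move=> e; apply: ext => p Cp /=; rewrite !gen_act_bvec //=.
  case: eqP => [sp|_]; rewrite ?linear0 // gen_act_bvec /=; last exact: consC.
  by rewrite pfirst_pcons eqxx ptail_pcons.
- move=> e f ef; apply: ext => p Cp /=; rewrite gen_act_bvec //=.
  case: eqP => [sp|_]; rewrite ?linear0 // gen_act_bvec /=; last exact: consC.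
  by rewrite pfirst_pcons; case: eqP => // -[fe]; case: ef.
- move=> v l ul l0 lv; apply: ext => p Cp.
  have ckE (l' : seq (edge E)) : term_act (ck2_sum K l') (bvec p) =
      \sum_(e <- l') gen_act (Edg e) (gen_act (Gst e) (bvec p)).
    by elim: l' => [|e l' IH]; rewrite ?big_nil ?big_cons //= IH.
  rewrite ckE /= gen_act_bvec //=.
  have other e : pfirst p <> Some e -> gen_act (Edg e) (gen_act (Gst e) (bvec p)) = 0.
    by move=> fp; rewrite [gen_act (Gst e) _]gen_act_bvec //=; case: eqP => // _; exact: linear0.
  have this e : pfirst p = Some e -> gen_act (Edg e) (gen_act (Gst e) (bvec p)) = bvec p.
    move=> fp; have [pE Ct st] := tailC _ _ Cp fp.
    rewrite [gen_act (Gst e) _]gen_act_bvec //= fp eqxx.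
    by rewrite gen_act_bvec //= st eqxx -pE.
  case: (hC.2 _ Cp) => [[e [p' [pE _ _]]]|[w [pE sw]]].
    have fp : pfirst p = Some e by rewrite pE pfirst_pcons.
    have -> : asource p = src e by rewrite pE asource_pcons.
    case: eqP => [/lv el|nl].
      rewrite (bigD1_seq e) //= this // big1 ?addr0 // => e' e'e.
      by apply: other; rewrite fp => -[ee]; rewrite ee eqxx in e'e.
    rewrite big_seq big1 // => e' /lv se'; apply: other; rewrite fp => -[ee].
    by apply: nl; rewrite ee.
  have -> : (asource p == v) = false.
    apply/eqP => sp; case: l l0 lv {ul ckE} => // e l _ lv.
    have /lv se : e \in e :: l by rewrite mem_head.
    by move: (sw e); rewrite se -sp pE.
  by rewrite big1 // => e _; apply: other; rewrite pE.
Qed.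

Definition path_act (a : lpa K E) (m : path_space) : path_space := term_act (repr a) m.

Lemma path_act_class t m : path_act (lpa_class t) m = term_act t m.
Proof. exact/term_act_eq/lpa_repr. Qed.

Fact path_actDl a b m : path_act (a + b) m = path_act a m + path_act b m.
Proof.
elim/lpa_ind: a => t; elim/lpa_ind: b => u.
by rewrite lpaDE !path_act_class.
Qed.
Fact path_actDr a m n : path_act a (m + n) = path_act a m + path_act a n.
Proof. exact: linearD. Qed.
Fact path_actZl k a m : path_act (k *: a) m = k *: path_act a m.
Proof. by elim/lpa_ind: a => t; rewrite lpaZE !path_act_class. Qed.
Fact path_actZr k a m : path_act a (k *: m) = k *: path_act a m.
Proof. exact: linearZ. Qed.
Fact path_actM a b m : path_act (nmul a b) m = path_act a (path_act b m).
Proof.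
elim/lpa_ind: a => t; elim/lpa_ind: b => u.
by rewrite lpaME !path_act_class.
Qed.
Fact path_act_unital m : exists s : seq (lpa K E * path_space),
  m = \sum_(x <- s) path_act x.1 x.2.
Proof.
pose term b := (m : {malg K[path_basis]})@_b *: bvec (val b).
exists [seq (lpa_of K (Vtx (asource (val b))), term b)
       | b : path_basis <- msupp (m : {malg K[path_basis]})].
rewrite big_map [LHS]monalgE; apply: eq_bigr => -[p Cp] _ /=.
have Cp' : C p by apply/asboolP.
rewrite path_actZr [path_act _ _]path_act_class /= gen_act_bvec //= eqxx.
apply/malgP => b; rewrite (bvecE Cp) mcoeffZ !mcoeffU.
by case: eqP => _; rewrite ?mulr1n ?mulr1 ?mulr0n ?mulr0.
Qed.

Definition path_module : numodule (lpa K E) :=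
  NUModule path_actDl path_actDr path_actZl path_actZr path_actM path_act_unital.

Local Notation gx g := (lpa_of K g).

Lemma path_act_vtx v p : C p ->
  mact (gx (Vtx v)) (bvec p : path_module) = if asource p == v then bvec p else 0.
Proof. by move=> Cp; rewrite [LHS]path_act_class /= gen_act_bvec. Qed.

Lemma path_act_edge e p : C p -> asource p = rng e ->
  mact (gx (Edg e)) (bvec p : path_module) = bvec (pcons e p).
Proof.
by move=> Cp sp; rewrite [LHS]path_act_class /= gen_act_bvec //= sp eqxx.
Qed.

Lemma path_act_ghost e p : C p ->
  mact (gx (Gst e)) (bvec p : path_module) =
  if pfirst p == Some e then bvec (ptail p) else 0.
Proof. by move=> Cp; rewrite [LHS]path_act_class /= gen_act_bvec. Qed.

Lemma act_lpa_path mu (m : path_module) :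
  mact (lpa_path K mu) m =
  mact (gx (Vtx (psource mu))) (foldr (fun e => mact (gx (Edg e))) m (pedges mu)).
Proof.
rewrite /lpa_path; elim: (pedges mu) (gx _) => [|e l IH] a //.
by rewrite [foldl _ _ _]/= IH actM.
Qed.

Lemma path_act_path mu p : C p -> prange mu = asource p ->
  mact (lpa_path K mu) (bvec p : path_module) = bvec (pcat mu p).
Proof.
move=> Cp; rewrite act_lpa_path; case: mu => v l w.
rewrite /prange /pcat [psource _]/= [pedges _]/= => se.
have [-> Cq sq] : [/\ foldr (fun e => mact (gx (Edg e))) (bvec p : path_module) l =
    bvec (foldr (@pcons E) p l), C (foldr (@pcons E) p l) &
    asource (foldr (@pcons E) p l) = v].
  elim: l v w se => [|e l IH] v /=; first by rewrite /walk_end.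
  move=> /andP[/eqP <- w] se; have [-> Cq sq] := IH _ w se.
  split; [exact: path_act_edge | exact: hC.1 | exact: asource_pcons].
by rewrite path_act_vtx // sq eqxx.
Qed.

Lemma act_lpa_ghost nu (m : path_module) :
  mact (lpa_ghost K nu) m =
  foldl (fun n e => mact (gx (Gst e)) n) (mact (gx (Vtx (psource nu))) m) (pedges nu).
Proof.
rewrite /lpa_ghost; elim: (pedges nu) (gx _) => [|e l IH] a //.
by rewrite [foldl _ _ (e :: l)]/= IH actM.
Qed.

Lemma foldl_ghost0 l :
  foldl (fun n e => mact (gx (Gst e)) n) (0 : path_module) l = 0.
Proof. by elim: l => //= e l; rewrite [mact _ 0]linear0. Qed.

(* The action of the elements [mu nu^*], which span [L_K(E)]: [mu nu^*] sends a
   basis path [p] to [mu p'] if [p = nu p'], and to [0] if [nu] is not an initial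
   segment of [p]. *)
Lemma path_module_act (mu nu : fpath E) (p p' : anypath E) :
  prange mu = prange nu -> C p -> factors nu p' p ->
  mact (nmul (lpa_path K mu) (lpa_ghost K nu)) (bvec p : path_module) =
  bvec (pcat mu p').
Proof.
move=> mn Cp [sp' pE]; rewrite actM act_lpa_ghost.
have sp : asource p = psource nu.
  rewrite pE; case: nu {mn pE} sp' => v [|e l] w; first by rewrite /pcat.
  by move=> _; rewrite /pcat /= asource_pcons; have /andP[/eqP] := w.
rewrite path_act_vtx // sp eqxx.
have [-> Cp'] : foldl (fun n e => mact (gx (Gst e)) n) (bvec p : path_module)
    (pedges nu) = bvec p' /\ C p'.
  case: nu sp' pE {mn sp} => v l w; rewrite /prange /pcat /=.
  elim: l v w p Cp => [|e l IH] v w p Cp /= se pE; first by rewrite -pE.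
  have /andP[_ w'] : (src e == v) && is_walk (rng e) l := w.
  have fp : pfirst p = Some e by rewrite pE pfirst_pcons.
  rewrite path_act_ghost // fp eqxx.
  have sq : asource (foldr (@pcons E) p' l) = rng e.
    case: l w' se {IH w pE} => [|f l] w' se //=.
    by rewrite asource_pcons; have /andP[/eqP] := w'.
  have tE : ptail p = foldr (@pcons E) p' l by rewrite pE ptail_pcons.
  apply: (IH (rng e)) => //.
  case: (hC.2 _ Cp) => [[f [q [pE' sf Cq]]]|[u [pu _]]]; last by rewrite pu in fp.
  by rewrite pE' ptail_pcons.
by rewrite path_act_path // mn.
Qed.

Lemma path_module_act0 (mu nu : fpath E) (p : anypath E) :
  C p -> (forall p', ~ factors nu p' p) ->
  mact (nmul (lpa_path K mu) (lpa_ghost K nu)) (bvec p : path_module) = 0.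
Proof.
move=> Cp nf; rewrite actM act_lpa_ghost path_act_vtx //.
suff -> : foldl (fun n e => mact (gx (Gst e)) n)
    (if asource p == psource nu then bvec p : path_module else 0) (pedges nu) = 0.
  exact: linear0.
case: eqP => [sp|_]; last exact: foldl_ghost0.
case: nu sp nf => v l w /=.
elim: l v w p Cp => [|e l IH] v w p Cp /= sp nf; first by case: (nf p).
have /andP[/eqP se w'] : (src e == v) && is_walk (rng e) l := w.
rewrite path_act_ghost //; case: eqP => [fp|_]; last exact: foldl_ghost0.
case: (hC.2 _ Cp) => [[f [q [pE sf Cq]]]|[u [pu _]]]; last by rewrite pu in fp.
move: fp; rewrite pE pfirst_pcons => -[fe]; subst f.
rewrite ptail_pcons //; apply: (IH (rng e) w' q Cq sf) => q' [qs qE].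
by apply: (nf q'); split => //; rewrite pE qE.
Qed.

End ChenModule.

(** * Twisted modules and restriction of scalars *)

Lemma act_vertex_span (K : fieldType) (E : graph) (M : numodule (lpa K E)) (m : M) :
  exists s : seq (vertex E * M), m = \sum_(x <- s) mact (lpa_of K (Vtx x.1)) x.2.
Proof.
pose span (n : M) := exists s : seq (vertex E * M),
  n = \sum_(x <- s) mact (lpa_of K (Vtx x.1)) x.2.
have span0 : span 0 by exists [::]; rewrite big_nil.
have spanD n p : span n -> span p -> span (n + p).
  by move=> [s ->] [s' ->]; exists (s ++ s'); rewrite big_cat.
have spanV v n : span (mact (lpa_of K (Vtx v)) n).
  by exists [:: (v, n)]; rewrite big_seq1.
have spanZ k n : span n -> span (k *: n).
  move=> [s ->]; exists [seq (x.1, k *: x.2) | x <- s].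
  by rewrite big_map scaler_sumr; apply: eq_bigr => x _; rewrite actZr.
have a0 (n : M) : mact (0 : lpa K E) n = 0.
  by rewrite -(scale0r (0 : lpa K E)) actZl scale0r.
have span_act a n : span (mact a n).
  elim/lpa_ind: a n => t; elim: t => [|g|t IHt u IHu|k t IHt|t IHt u IHu] n.
  - by rewrite (a0 n).
  - have [v ->] : exists v, lpa_class (TGen K g) =
        nmul (lpa_of K (Vtx v)) (lpa_class (TGen K g)).
      case: g => [v|e|e]; [exists v|exists (src e)|exists (rng e)];
        rewrite lpaME; apply/lpa_classP/cg_sym;
        [exact: rel_vv|exact: rel_se|exact: rel_rg].
    by rewrite actM.
  - by rewrite -lpaDE actDl; apply: spanD.
  - by rewrite -lpaZE actZl; apply: spanZ.
  - by rewrite -lpaME actM.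
have [s ->] := act_unital m.
by elim: s => [|x s IH]; rewrite ?big_nil // big_cons; apply: spanD.
Qed.

Section GaugeModule.
Variables (K : fieldType) (E : graph) (a : edge E -> K).
Hypothesis ha : forall e, a e != 0.
Variable M : numodule (lpa K E).

Definition gauge_act (x : lpa K E) (m : M) : M := mact (gauge a x) m.

Fact gauge_actDl x y m : gauge_act (x + y) m = gauge_act x m + gauge_act y m.
Proof. by rewrite /gauge_act /gauge lpa_twistD // actDl. Qed.
Fact gauge_actDr x m n : gauge_act x (m + n) = gauge_act x m + gauge_act x n.
Proof. exact: actDr. Qed.
Fact gauge_actZl k x m : gauge_act (k *: x) m = k *: gauge_act x m.
Proof. by rewrite /gauge_act /gauge lpa_twistZ // actZl. Qed.
Fact gauge_actZr k x m : gauge_act x (k *: m) = k *: gauge_act x m.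
Proof. exact: actZr. Qed.
Fact gauge_actM x y m : gauge_act (nmul x y) m = gauge_act x (gauge_act y m).
Proof. by rewrite /gauge_act /gauge lpa_twistM // actM. Qed.
Fact gauge_act_unital m : exists s : seq (lpa K E * M),
  m = \sum_(x <- s) gauge_act x.1 x.2.
Proof.
have [s ->] := act_vertex_span m.
exists [seq (lpa_of K (Vtx x.1), x.2) | x <- s]; rewrite big_map.
by apply: eq_bigr => x _; rewrite /gauge_act /gauge lpa_twist_vertex.
Qed.

Definition gauge_module : numodule (lpa K E) :=
  NUModule gauge_actDl gauge_actDr gauge_actZl gauge_actZr gauge_actM
    gauge_act_unital.

End GaugeModule.

Section RestrictScalars.
Variables (K K' : fieldType) (iota : {rmorphism K -> K'}).

(* The ring morphism is an argument so that the [K]-module structure can be inferred. *)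
Definition restricted (h : {rmorphism K -> K'}) (V : lmodType K') : Type := V.
HB.instance Definition _ h (V : lmodType K') := GRing.Zmodule.on (restricted h V).

Section Scale.
Variable V : lmodType K'.

Definition restricted_scale (k : K) (m : restricted iota V) : restricted iota V :=
  iota k *: (m : V).

Fact restricted_scaleA k h m :
  restricted_scale k (restricted_scale h m) = restricted_scale (k * h) m.
Proof. by rewrite /restricted_scale scalerA rmorphM. Qed.
Fact restricted_scale1 : left_id 1 restricted_scale.
Proof. by move=> m; rewrite /restricted_scale rmorph1 scale1r. Qed.
Fact restricted_scaleDr : right_distributive restricted_scale +%R.
Proof. by move=> k m n; rewrite /restricted_scale scalerDr. Qed.
Fact restricted_scaleDl m : {morph restricted_scale^~ m : k h / k + h}.
Proof. by move=> k h; rewrite /restricted_scale rmorphD scalerDl. Qed.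

HB.instance Definition _ := GRing.Zmodule_isLmodule.Build K (restricted iota V)
  restricted_scaleA restricted_scale1 restricted_scaleDr restricted_scaleDl.
End Scale.

Variables (E : graph) (M : numodule (lpa K' E)).

Definition restricted_act (x : lpa K E) (m : restricted iota M) : restricted iota M :=
  mact (base_change iota x) (m : M).

Let one_neq0 (e : edge E) : (1 : K') != 0 := oner_neq0 K'.

Fact restricted_actDl x y m :
  restricted_act (x + y) m = restricted_act x m + restricted_act y m.
Proof. by rewrite /restricted_act /base_change lpa_twistD // actDl. Qed.
Fact restricted_actDr x m n :
  restricted_act x (m + n) = restricted_act x m + restricted_act x n.
Proof. exact: actDr. Qed.
Fact restricted_actZl k x m :
  restricted_act (k *: x) m = k *: restricted_act x m.
Proof. by rewrite /restricted_act /base_change lpa_twistZ // actZl. Qed.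
Fact restricted_actZr k x m :
  restricted_act x (k *: m) = k *: restricted_act x m.
Proof. exact: actZr. Qed.
Fact restricted_actM x y m :
  restricted_act (nmul x y) m = restricted_act x (restricted_act y m).
Proof. by rewrite /restricted_act /base_change lpa_twistM // actM. Qed.
Fact restricted_act_unital m : exists s : seq (lpa K E * restricted iota M),
  m = \sum_(x <- s) restricted_act x.1 x.2.
Proof.
have [s ->] := act_vertex_span (m : M).
exists [seq (lpa_of K (Vtx x.1), x.2) | x <- s]; rewrite big_map.
by apply: eq_bigr => x _; rewrite /restricted_act /base_change lpa_twist_vertex.
Qed.

Definition restrict_module : numodule (lpa K E) :=
  NUModule restricted_actDl restricted_actDr restricted_actZl restricted_actZr
    restricted_actM restricted_act_unital.

End RestrictScalars.

(** * The modules of the classification *)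

(* [V_[x]] for a sink [x]. *)
Definition sink_module (K : fieldType) (E : graph) (x : sink E) :
  numodule (lpa K E) := path_module K (sink_class_closed x).

(* [V_[x]] for an infinite path [x]. *)
Definition inf_module (K : fieldType) (E : graph) (x : ipath E) :
  numodule (lpa K E) := path_module K (inf_class_closed x).

Section CycleModule.
Variables (K : fieldType) (E : graph) (c : gcycle E) (f : {poly K}).
Hypotheses (hf : monic_irreducible_poly f) (hX : f != 'X).

(* [K[t] / (f)]; since [f] is irreducible and different from [t], the class of
   [t] is already invertible there, so that this is [K[t, t^-1] / (f)]. *)
Let K' := {poly %/ f with hf}.
Let tbar : K' := 'qX.

Lemma tbar_neq0 : tbar != 0.
Proof.
apply: contra hX => /eqP /(congr1 val) /=.
rewrite (mk_monicE hf) => rX.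
have fX : f %| 'X.
  by apply/modp_eq0P; rewrite Pdiv.IdomainMonic.modpE ?hf.2.
have sf : size f = size ('X : {poly K}).
  apply/eqP; rewrite eqn_leq (dvdp_leq _ fX) ?polyX_eq0 //.
  by rewrite size_polyX; case: hf => -[].
have : f %= 'X by rewrite -(dvdp_size_eqp fX) sf.
by rewrite eqp_monic ?hf.2 ?monicX.
Qed.

Definition cycle_scalars (e : edge E) : K' :=
  if e == first_edge c then tbar else 1.

Fact cycle_scalars_neq0 e : cycle_scalars e != 0.
Proof. by rewrite /cycle_scalars; case: ifP; rewrite ?tbar_neq0 ?oner_neq0. Qed.

(* [V^f_[c^oo]] *)
Definition cycle_module : numodule (lpa K E) :=
  restrict_module (in_alg K')
    (gauge_module cycle_scalars_neq0 (inf_module K' (cycle_inf c))).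

End CycleModule.

(* Main.v *)
(** Let [M] be a finite-dimensional simple module.  If [l] is a closed walk at [v],
    it acts injectively, hence surjectively, on the component [v M], so an edge leaving
    the walk must end at a vertex [w] with [w M = 0].  The support of [M] is finite and
    closed under predecessors; a sink or a cycle in it is therefore maximal with finitely
    many predecessors.  At a sink take any nonzero vector; at a cycle [c] take a vector
    killed by an irreducible polynomial [f] in the action of [c].  The same kind of
    vector exists in [V_[x]] or [V^f_[c^oo]], and two simple modules with matching
    vectors [m] and [n] are isomorphic: since closed walks at the base vertex are powers
    of [c], the submodule of [M * N] generated by [(m, n)] is the graph of an
    isomorphism. *)

Require Import Defs.
From HB Require Import structures.
From mathcomp Require Import all_boot all_algebra all_field.
From mathcomp Require Import boolp classical_sets cardinality.
From mathcomp Require Import finmap monalg zify.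

Set Implicit Arguments.
Unset Strict Implicit.
Unset Printing Implicit Defensive.

Import GRing.Theory.
Local Open Scope ring_scope.
Local Arguments cycle_edges : simpl never.
Local Arguments mact : simpl never.

(** * Walks, cycles and maximality *)

(** Row-finiteness enters twice. If [m] is a nonzero vector of [v M] and [v] is not a sink, the
    relation at [v] writes [m] as the finite sum of the [e (e^* m)], so some [e^* m] is nonzero: a
    vertex of the support that is not a sink emits an edge into the support. As the support is
    finite, it contains a sink or a cycle. Row-finiteness also makes the set of edges emitted by the
    predecessors finite, hence the classes [[x]] and [[c^oo]].

    Maximality of [c] means for the class of [c^oo] that exactly one of its paths starts at the base
    vertex. So the component of [V^f_[c^oo]] there is one copy of [L = K[t]/(f)], on which [c] acts
    as multiplication by [t]. Simplicity follows because [L] is a field generated by [t], and [f] is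
    recovered as the generator of the annihilator of any nonzero vector of that component.

    The isomorphism is built as a relation because a map sending each [mu m] to [mu n] would first
    have to be shown well defined. For a relation, the fibre over [0] is a submodule, and simplicity
    leaves only two cases. *)

Section Walks.
Variable E : graph.
Implicit Types (e f : edge E) (u v w : vertex E) (l : seq (edge E)) (c d : gcycle E).

Lemma is_walk_cat v l1 l2 :
  is_walk v (l1 ++ l2) = is_walk v l1 && is_walk (walk_end v l1) l2.
Proof. by elim: l1 v => //= e l1 IH v; rewrite IH andbA. Qed.

Lemma walk_end_cat v l1 l2 :
  walk_end v (l1 ++ l2) = walk_end (walk_end v l1) l2.
Proof. by rewrite /walk_end map_cat last_cat. Qed.

Lemma walk_to_edge v l1 e l2 :
  is_walk v (l1 ++ e :: l2) ->
  [/\ is_walk v l1, walk_end v l1 = src e, is_walk (src e) (e :: l2) &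
      walk_end v (l1 ++ e :: l2) = walk_end (rng e) l2].
Proof. by rewrite is_walk_cat walk_end_cat /= => /and3P[-> /eqP <- ->]; rewrite eqxx. Qed.

Lemma reachesP u v :
  reaches u v <-> exists l, is_walk u l /\ walk_end u l = v.
Proof.
split=> [[[u' l w] /= [<- <-]]|[l [w <-]]]; first by exists l.
by exists (FPath w).
Qed.

Lemma reaches_refl v : reaches v v.
Proof. by apply/reachesP; exists [::]. Qed.

Lemma reaches_trans u v w : reaches u v -> reaches v w -> reaches u w.
Proof.
move=> /reachesP[l [wl <-]] /reachesP[l' [wl' <-]]; apply/reachesP.
by exists (l ++ l'); rewrite is_walk_cat wl wl' walk_end_cat.
Qed.

Lemma reaches_edge e : reaches (src e) (rng e).
Proof. by apply/reachesP; exists [:: e]; rewrite /= eqxx. Qed.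

Lemma reaches_walk v l e : is_walk v l -> e \in l ->
  reaches v (src e) /\ reaches (rng e) (walk_end v l).
Proof.
move=> wl /splitPr el; case: el wl => l1 l2 /walk_to_edge[w1 s1 w2 ->].
split; apply/reachesP; first by exists l1.
by exists l2; move: w2 => /= /andP[].
Qed.

Lemma closed_walk_cycle e l :
  is_walk (src e) (e :: l) -> walk_end (rng e) l = src e ->
  uniq (map src (e :: l)) -> exists c, cycle_edges c = e :: l.
Proof. by move=> wl cl ul; exists (Cycle wl cl ul). Qed.

(** Peeling edges off the front, one reaches a first edge whose source recurs in a tail without
    repetitions; the segment up to that recurrence is a cycle. *)
Lemma walk_cycle v l : is_walk v l -> ~~ uniq (map src l) ->
  exists c l1 l2, l = l1 ++ cycle_edges c ++ l2.
Proof.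
elim: l v => // e l IH v /andP[/eqP se wl]; rewrite [uniq _]/= negb_and negbK.
have [ul|nul _] := boolP (uniq (map src l)); last first.
  by have [c [l1 [l2 ->]]] := IH _ wl nul; exists c, (e :: l1), l2.
rewrite orbF => /mapP[f /splitPr fl sf].
case: fl ul wl => la lb ul wl.
have [wa ea _ _] := walk_to_edge wl.
have [|||c ce] := @closed_walk_cycle e la.
- by rewrite /= eqxx.
- by rewrite ea -sf.
- move: ul; rewrite map_cat cat_uniq /= => /and3P[-> /norP[nf _] _].
  by rewrite sf nf.
by exists c, [::], (f :: lb); rewrite ce.
Qed.

(** The point is that the cycle starts with the prescribed edge [e]. A cycle found in the closed
    walk either begins at [e], or can be cut out without touching [e]. *)
Lemma closed_walk_shorten e l :
  is_walk (rng e) l -> walk_end (rng e) l = src e ->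
  exists c, first_edge c = e.
Proof.
have [n] := ubnP (size l); elim: n l => // n IH l ln wl cl.
have [ul|nul] := boolP (uniq (map src (e :: l))).
  have we : is_walk (src e) (e :: l) by rewrite /= eqxx.
  by exists (Cycle we cl ul).
have we : is_walk (src e) (e :: l) by rewrite /= eqxx.
have [c [l1 [l2]]] := walk_cycle we nul.
case: l1 => [[ec _]|f l1 [_]]; first by exists c.
rewrite -[_ :: _ ++ _]/(cycle_edges c ++ l2) => lE.
move: wl cl; rewrite lE is_walk_cat is_walk_cat !walk_end_cat.
case/and3P=> w1 wc w2.
have s1 : walk_end (rng e) l1 = cycle_base c by move: wc => /= /andP[/eqP].
have ec : walk_end (cycle_base c) (cycle_edges c) = cycle_base c.
  exact: cycle_closed.
move: w2; rewrite s1 ec => w2 cl; apply: (IH (l1 ++ l2)).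
- by rewrite -ltnS; apply: leq_trans ln; rewrite lE !size_cat ltnS -addnS leq_add2l ltnS leq_addl.
- by rewrite is_walk_cat w1 s1.
- by rewrite walk_end_cat s1.
Qed.

Lemma cycle_edge_loop c e : e \in cycle_edges c ->
  reaches (cycle_base c) (src e) /\ reaches (rng e) (cycle_base c).
Proof.
move=> ec; have [ce] := reaches_walk (cycle_walk c) ec.
by rewrite cycle_closed.
Qed.

Lemma rotation_of_sym c d : rotation_of c d -> rotation_of d c.
Proof.
case=> i de; exists (size (cycle_edges d) - i)%N.
by rewrite de -/(rotr i _) rotK.
Qed.

Lemma rotation_of_mem c d : rotation_of c d -> cycle_edges d =i cycle_edges c.
Proof. by case=> i -> e; rewrite mem_rot. Qed.

Lemma mem_first_edge c : first_edge c \in cycle_edges c.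
Proof. exact: mem_head. Qed.

Section Maximal.
Variable c : gcycle E.
Hypothesis cmax : maximal_cycle c.

Lemma maximal_cycle_rotation d :
  reaches (cycle_base d) (cycle_base c) -> rotation_of c d.
Proof. by move=> dc; apply: contrapT => /cmax. Qed.

Lemma maximal_cycle_edge d e : reaches (cycle_base d) (cycle_base c) ->
  e \in cycle_edges d -> e \in cycle_edges c.
Proof. by move=> /maximal_cycle_rotation/rotation_of_mem ->. Qed.

(** The combinatorial core of maximality. An edge leaving the cycle and leading back to it starts a
    cycle that reaches [c], hence a rotation of [c]; and a cycle has only one edge at each of its
    vertices. *)
Lemma maximal_cycle_unique_edge e f : f \in cycle_edges c -> src e = src f ->
  reaches (rng e) (cycle_base c) -> e = f.
Proof.
move=> fc ef ec; have [cf _] := cycle_edge_loop fc.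
have /reachesP[l [wl el]] : reaches (rng e) (src e).
  by rewrite ef; exact: reaches_trans ec cf.
have [d de] := closed_walk_shorten wl el.
have ec' : e \in cycle_edges c.
  apply: (@maximal_cycle_edge d); last by rewrite -de mem_first_edge.
  by rewrite /cycle_base de; exact: reaches_trans (reaches_edge e) ec.
have [k kl ke] := nthP e ec'; have [j jl je] := nthP e fc.
move: ef; rewrite -ke -je -!(nth_map e (src e)) // => /eqP.
by rewrite nth_uniq ?size_map ?(cycle_uniq c) // => /eqP ->.
Qed.

End Maximal.

(** A repeated source would give a cycle from which [x] is reached. This bounds the length of the
    paths ending at [x] by the number of predecessors. *)
Lemma maximal_sink_uniq (x : sink E) v l : maximal_sink x ->
  is_walk v l -> walk_end v l = x -> uniq (map src l).
Proof.
move=> xmax wl lx; have [//|/(walk_cycle wl)[c [l1 [l2 lE]]]] := boolP (uniq _).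
case: (xmax c); rewrite -lx; apply: reaches_trans (reaches_edge (first_edge c)) _.
apply: (reaches_walk wl _).2.
by rewrite lE !mem_cat mem_first_edge orbT.
Qed.

End Walks.

(** * The classes of a maximal sink and of a maximal cycle *)

Section PathClasses.
Variable E : graph.
Implicit Types (e f : edge E) (u v w : vertex E) (l : seq (edge E)) (c d : gcycle E).
Implicit Types (x y z : ipath E) (p q : anypath E).

(** This is [pcat] on a bare word, so that inductions on the word need not carry a path record. *)
Definition prepend l p : anypath E := foldr (@pcons E) p l.

Lemma prepend_inf l (g : nat -> edge E) :
  prepend l (InfPath g) =
  InfPath (fun n => if (n < size l)%N then nth (g 0%N) l n else g (n - size l)%N).
Proof.
elim: l => [|e l IH] /=; first by congr InfPath; apply/funext => n; rewrite subn0.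
by rewrite IH; congr InfPath; apply/funext => -[|n] //=; rewrite ltnS subSS.
Qed.

Lemma ipath_walk x n :
  is_walk (src (x 0%N)) (mkseq x n) /\ walk_end (src (x 0%N)) (mkseq x n) = src (x n).
Proof.
elim: n => [|n [w e]] //; rewrite mkseqS -cats1 is_walk_cat walk_end_cat w e /=.
by rewrite eqxx; split=> //; exact: iedgeP.
Qed.

Lemma ishift_subproof x i n : rng (x (i + n)%N) = src (x (i + n.+1)%N).
Proof. by rewrite addnS iedgeP. Qed.
Definition ishift i x : ipath E := IPath (ishift_subproof x i).

Lemma ishift_prepend i x : of_ipath x = prepend (mkseq x i) (of_ipath (ishift i x)).
Proof.
rewrite /of_ipath prepend_inf; congr InfPath; apply/funext => n.
rewrite size_mkseq; case: ltnP => [ni|ni]; first by rewrite nth_mkseq.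
by rewrite /= subnKC.
Qed.

Lemma ipath_reaches x i j : (i <= j)%N -> reaches (src (x i)) (src (x j)).
Proof.
move=> ij; apply/reachesP; exists (mkseq (ishift i x) (j - i)).
have [w e] := ipath_walk (ishift i x) (j - i).
by rewrite /= addn0 in w e; rewrite w e subnKC.
Qed.

(** Tail equivalence by indices, which turns statements on concatenation into arithmetic. *)
Lemma inf_classP x q : inf_class x q <->
  exists y, q = of_ipath y /\ exists i j, forall k, y (i + k)%N = x (j + k)%N.
Proof.
split=> [[y [-> [mu [nu [p [[_ xE] [_ yE]]]]]]]|[y [-> [i [j yx]]]]].
  exists y; split=> //; exists (size (pedges nu)), (size (pedges mu)) => k.
  move: xE yE; rewrite /of_ipath /pcat -!/(prepend _ _) !prepend_inf => -[->] [->].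
  by rewrite !ltnNge !leq_addr /= !addKn.
exists y; split=> //.
have [[wx ex] [wy ey]] := (ipath_walk x j, ipath_walk y i).
exists (FPath wx), (FPath wy), (ishift i y); split; split.
- by rewrite /prange /= ex addn0 -[i]addn0 yx addn0.
- rewrite /pcat /= -/(prepend _ _) [LHS](ishift_prepend j); congr prepend.
  by congr InfPath; apply/funext => k /=; rewrite yx.
- by rewrite /prange /= ey addn0.
- by rewrite /pcat /= -/(prepend _ _) [LHS](ishift_prepend i).
Qed.

Lemma inf_class_refl x : inf_class x (of_ipath x).
Proof. by apply/inf_classP; exists x; split=> //; exists 0%N, 0%N. Qed.

Lemma cycle_infE c k :
  cycle_inf c k = nth (first_edge c) (cycle_edges c) (k %% size (cycle_edges c)).
Proof. by []. Qed.

Lemma cycle_inf_mem c k : cycle_inf c k \in cycle_edges c.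
Proof. by rewrite cycle_infE mem_nth // ltn_mod. Qed.

Lemma cycle_inf_index c e : e \in cycle_edges c -> exists k, cycle_inf c k = e.
Proof.
by case/(nthP (first_edge c)) => k kl <-; exists k; rewrite cycle_infE modn_small.
Qed.

Lemma cycle_inf_prefix c : mkseq (cycle_inf c) (size (cycle_edges c)) = cycle_edges c.
Proof.
apply: (@eq_from_nth _ (first_edge c)); rewrite size_mkseq // => i il.
by rewrite nth_mkseq // cycle_infE modn_small.
Qed.

Lemma cycle_inf_period c m k :
  cycle_inf c (m * size (cycle_edges c) + k)%N = cycle_inf c k.
Proof. by rewrite !cycle_infE modnMDl. Qed.

Lemma asource_cycle_inf c : asource (of_ipath (cycle_inf c)) = cycle_base c.
Proof. by rewrite -[asource _]/(src (cycle_inf c 0%N)) cycle_infE mod0n. Qed.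

Lemma cycle_inf_rot c d i : cycle_edges d = rot i (cycle_edges c) ->
  exists j, forall k, cycle_inf d k = cycle_inf c (j + k)%N.
Proof.
move=> de; have sd : size (cycle_edges d) = size (cycle_edges c).
  by rewrite de size_rot.
case: (ltnP i (size (cycle_edges c))) => [il|il]; last first.
  exists 0%N => k; rewrite !cycle_infE sd de rot_oversize //.
  by apply: set_nth_default; rewrite ltn_mod.
exists i => k; rewrite !cycle_infE sd de /rot nth_cat size_drop -modnDmr.
have : (k %% size (cycle_edges c) < size (cycle_edges c))%N by rewrite ltn_mod.
(* Position [i + m] either lies before the end of [c], in the dropped part of the rotation, or wraps
   around into the taken part. *)
move: (k %% _)%N => m ml; case: ltnP => lt.
  rewrite nth_drop modn_small; last by lia.
  by apply: set_nth_default; lia.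
rewrite nth_take; last by lia.
rewrite -[X in (X %% _)%N](@subnK (size (cycle_edges c))); last by lia.
rewrite modnDr modn_small; last by lia.
have -> : (i + m - size (cycle_edges c) = m - (size (cycle_edges c) - i))%N by lia.
by apply: set_nth_default; lia.
Qed.

Lemma inf_class_rot c d : rotation_of c d ->
  inf_class (cycle_inf d) = inf_class (cycle_inf c).
Proof.
move=> cd; have sub c1 d1 : rotation_of c1 d1 ->
    forall q, inf_class (cycle_inf d1) q -> inf_class (cycle_inf c1) q.
  move=> [i /cycle_inf_rot[j jE]] q /inf_classP[y [-> [m [n mn]]]].
  apply/inf_classP; exists y; split=> //; exists m, (j + n)%N => k.
  by rewrite mn jE addnA.
by apply/seteqP; split; apply: sub => //; exact: rotation_of_sym.
Qed.

Lemma cycle_class_prepend c p : inf_class (cycle_inf c) p ->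
  exists l, [/\ is_walk (asource p) l, walk_end (asource p) l = cycle_base c &
               p = prepend l (of_ipath (cycle_inf c))].
Proof.
move=> /inf_classP[y [-> [i [j yx]]]].
set n := size (cycle_edges c).
have n0 : (0 < n)%N by [].
(* Since [y] from [i] on is [c^oo] from [j] on, another [j * n - j] edges bring the index in [c^oo]
   to [j * n], a multiple of the period. *)
have yk k : y (i + (j * n - j) + k)%N = cycle_inf c k.
  have jn : (j <= j * n)%N by rewrite leq_pmulr.
  by rewrite -addnA yx addnA subnKC // cycle_inf_period.
have [w e] := ipath_walk y (i + (j * n - j)).
exists (mkseq y (i + (j * n - j))); split=> //.
  by have := yk 0%N; rewrite addn0 e => ->; rewrite -asource_cycle_inf.
rewrite [LHS](ishift_prepend (i + (j * n - j))); congr prepend.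
by congr InfPath; apply/funext => k; exact: yk.
Qed.

Lemma asource_prepend l p v : is_walk v l -> walk_end v l = asource p ->
  asource (prepend l p) = v.
Proof. by case: l => [|e l] //= /andP[/eqP se _] _; rewrite asource_pcons. Qed.

Lemma path_closed_prepend (C : set (anypath E)) l p v : path_closed C -> C p ->
  is_walk v l -> walk_end v l = asource p -> C (prepend l p).
Proof.
move=> hC Cp; elim: l v => [|e l IH] v //= /andP[_ wl] el.
by apply: hC.1; [exact: (IH (rng e))|exact: (asource_prepend wl el)].
Qed.

Section MaximalCycleClass.
Variable c : gcycle E.
Hypothesis cmax : maximal_cycle c.

Lemma cycle_class_reaches y k : inf_class (cycle_inf c) (of_ipath y) ->
  reaches (rng (y k)) (cycle_base c).
Proof.
move=> /inf_classP[z [[yz] [i [j zx]]]]; rewrite iedgeP.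
apply: (@reaches_trans _ _ (src (y (i + k.+1)%N))).
  by apply: ipath_reaches; rewrite leq_addl.
have -> : y (i + k.+1)%N = cycle_inf c (j + k.+1)%N by rewrite yz zx.
set e := cycle_inf c _; apply: reaches_trans (reaches_edge e) _.
by apply: (cycle_edge_loop _).2; exact: cycle_inf_mem.
Qed.

(** Every edge of a path of the class leads back to [c], and from a vertex of [c] only the edge of
    [c] does so. Two paths of the class that are at the same vertex of [c] at the same time
    therefore agree from then on. *)
Lemma cycle_class_follow y z i : inf_class (cycle_inf c) (of_ipath y) ->
  inf_class (cycle_inf c) (of_ipath z) -> y i \in cycle_edges c ->
  src (z i) = src (y i) -> forall k, z (i + k)%N = y (i + k)%N.
Proof.
move=> Cy Cz yi zi k.
suff [] : y (i + k)%N \in cycle_edges c /\ z (i + k)%N = y (i + k)%N by [].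
elim: k => [|k [yk zk]]; rewrite ?addn0 ?addnS.
  split=> //; apply: (maximal_cycle_unique_edge cmax) => //.
  exact: cycle_class_reaches.
have [n ny] := cycle_inf_index yk.
have yk1 : y (i + k).+1 = cycle_inf c n.+1.
  apply: (maximal_cycle_unique_edge cmax); first exact: cycle_inf_mem.
    by rewrite -!iedgeP ny.
  exact: cycle_class_reaches.
split; first by rewrite yk1 cycle_inf_mem.
apply: (maximal_cycle_unique_edge cmax).
- by rewrite yk1 cycle_inf_mem.
- by rewrite -!iedgeP zk.
- exact: cycle_class_reaches.
Qed.

Lemma cycle_class_base p d : rotation_of c d -> inf_class (cycle_inf c) p ->
  asource p = cycle_base d -> p = of_ipath (cycle_inf d).
Proof.
move=> cd /[dup] Cp /inf_classP[z [pz _]]; rewrite {}pz in Cp * => sz.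
congr InfPath; apply/funext => k; rewrite -[k]add0n.
apply: (@cycle_class_follow (cycle_inf d)) => //.
- by rewrite -(inf_class_rot cd); exact: inf_class_refl.
- by rewrite -(rotation_of_mem cd); exact: cycle_inf_mem.
Qed.

(** Pigeonhole: the first [size s + 1] sources are all predecessors, so the initial part of [y]
    contains a cycle; it reaches [c], hence is a rotation of [c]. *)
Lemma cycle_class_meets (s : seq (vertex E)) y :
  predecessors (cycle_base c) = [set` s]%classic ->
  inf_class (cycle_inf c) (of_ipath y) ->
  exists2 i, (i <= size s)%N & y i \in cycle_edges c.
Proof.
move=> sE Cy; have [wy _] := ipath_walk y (size s).+1.
have reach k : reaches (src (y k)) (cycle_base c).
  exact: reaches_trans (reaches_edge (y k)) (cycle_class_reaches _ Cy).
have nu : ~~ uniq (map src (mkseq y (size s).+1)).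
  apply/negP => /uniq_leq_size -/(_ s).
  rewrite size_map size_mkseq ltnn => h; suff : false by []; apply: h => v.
  case/mapP=> e /mapP[k _ ->] ->.
  have : predecessors (cycle_base c) (src (y k)) by exact: reach.
  by rewrite sE.
have [d [l1 [l2 lE]]] := walk_cycle wy nu.
have : first_edge d \in mkseq y (size s).+1.
  by rewrite lE !mem_cat mem_first_edge orbT.
case/mapP=> i; rewrite mem_iota add0n ltnS => /andP[_ il] di.
exists i => //; apply: (@maximal_cycle_edge _ _ cmax d).
  by rewrite /cycle_base di.
by rewrite -di mem_first_edge.
Qed.

End MaximalCycleClass.

Lemma finite_words (A : set (edge E)) n : finite_set A ->
  finite_set [set l | size l = n /\ forall e, e \in l -> A e]%classic.
Proof.
move=> fA; elim: n => [|n IH].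
  apply: (@sub_finite_set _ _ [set [::]]%classic); last exact: finite_set1.
  by move=> l [/size0nil].
apply: sub_finite_set (finite_image2 cons fA IH) => -[|e l] [] //= [ln] h.
exists e; first by apply: h; rewrite mem_head.
by exists l => //; split=> // f fl; apply: h; rewrite inE fl orbT.
Qed.

Definition emitted (P : set (vertex E)) : set (edge E) := [set e | P (src e)]%classic.

Lemma finite_emitted P : row_finite E -> finite_set P -> finite_set (emitted P).
Proof.
move=> hE fP; have -> : emitted P = (\bigcup_(v in P) [set e | src e = v])%classic.
  by apply/seteqP; split=> [e Pe|e [v Pv ev]]; [exists (src e)|rewrite /emitted /= ev].
by apply: bigcup_finite => // v _; exact: hE.
Qed.

(** A path of the class is determined by its first [size s + 1] edges: within them it gets onto [c],
    and from there its continuation is forced. *)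
Lemma finite_cycle_class c : row_finite E -> maximal_cycle c ->
  finitely_many_predecessors (cycle_base c) -> finite_set (inf_class (cycle_inf c)).
Proof.
move=> hE cmax fP; have [s sE] := (finite_seqP _).1 fP.
(* The default [[::]] never occurs on the class, which has infinite paths only. *)
pose word p := if p is InfPath g then mkseq g (size s).+1 else [::].
have inj : {in inf_class (cycle_inf c) &, injective word}.
  move=> p q /set_mem Cp /set_mem Cq.
  case/inf_classP: (Cp) (Cp) => y [-> _] Cy; case/inf_classP: (Cq) (Cq) => z [-> _] Cz.
  move=> /= yz.
  have yzk k : (k <= size s)%N -> z k = y k.
    move=> ks; move: (congr1 (nth (y 0%N) ^~ k) yz).
    by rewrite !nth_mkseq.
  have [i il yi] := cycle_class_meets cmax sE Cy.
  have follow := cycle_class_follow cmax Cy Cz yi (congr1 src (yzk i il)).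
  congr InfPath; apply/funext => k; case: (leqP k (size s)) => [/yzk //|ks].
  by rewrite -(subnKC (leq_trans il (ltnW ks))) follow.
rewrite -(eq_finite_set (inj_card_eq inj)).
apply: sub_finite_set (finite_words (size s).+1 (finite_emitted hE fP)).
move=> _ [p Cp <-]; case/inf_classP: (Cp) => y [py _] /=.
rewrite py; split=> [|e /mapP[k _ ->]]; first exact: size_mkseq.
apply: reaches_trans (reaches_edge (y k)) _.
by apply: cycle_class_reaches => //; rewrite -py.
Qed.

(** The sources along a path ending at [x] are distinct predecessors, so its length is at most
    [size s]. *)
Lemma finite_sink_class (x : sink E) : row_finite E -> maximal_sink x ->
  finitely_many_predecessors (x : vertex E) -> finite_set (sink_class x).
Proof.
move=> hE xmax fP; have [s sE] := (finite_seqP _).1 fP.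
have fW : finite_set (\bigcup_(n in `I_(size s).+1) [set l | size l = n /\
      forall e, e \in l -> emitted (predecessors (x : vertex E)) e])%classic.
  by apply: bigcup_finite => // n _; exact/finite_words/finite_emitted.
apply: sub_finite_set (finite_image2 (@FinPath E) fP fW) => p [[v l w] [-> xE]].
have vx : reaches v x by exists (FPath w).
rewrite /prange /= in xE.
have lP e : e \in l -> emitted (predecessors (x : vertex E)) e.
  move=> el; apply: reaches_trans (reaches_edge e) _.
  by rewrite -xE; exact: (reaches_walk w el).2.
exists v => //; exists l => //; exists (size l) => //=.
rewrite ltnS -(size_map src); apply: uniq_leq_size.
  exact: (maximal_sink_uniq xmax w).
move=> u /mapP[e el ->]; have : predecessors (x : vertex E) (src e) by exact: lP.
by rewrite sE.
Qed.

Lemma sink_class_prepend (x : sink E) p : sink_class x p ->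
  exists l, [/\ is_walk (asource p) l, walk_end (asource p) l = x &
               p = prepend l (FinPath (x : vertex E) [::])].
Proof.
move=> [[v l w] [-> xE]]; exists l; split=> //; rewrite /of_fpath /=.
have {}xE : walk_end v l = x := xE; rewrite -xE.
elim: l v w {xE} => //= e l IH v /andP[/eqP <- /IH].
by rewrite /walk_end /= => <-.
Qed.

(** Stated for any sink [v]: the case of [x] itself gives the uniqueness of the base path, and the
    other case separates the modules of different sinks. *)
Lemma sink_class_base (x : sink E) p v : sink_class x p -> is_sink v ->
  asource p = v -> v = x /\ p = FinPath v [::].
Proof.
move=> [[u [|e l] w] [-> xE]] vs /= uv; first by rewrite -uv -xE.
by have /andP[/eqP eu _] := w; case: (vs e); rewrite eu.
Qed.

End PathClasses.

(** * Walks along a maximal cycle *)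

Section CycleWalks.
Variable E : graph.
Implicit Types (e f : edge E) (v : vertex E) (l : seq (edge E)) (c d : gcycle E).

Lemma cycle_edge_next c f : f \in cycle_edges c ->
  exists2 g, g \in cycle_edges c & src g = rng f.
Proof.
move=> /cycle_inf_index[k <-]; exists (cycle_inf c k.+1); first exact: cycle_inf_mem.
by rewrite -iedgeP.
Qed.

Lemma cycle_src_inj c i j : (i < size (cycle_edges c))%N -> (j < size (cycle_edges c))%N ->
  src (cycle_inf c i) = src (cycle_inf c j) -> i = j.
Proof.
move=> il jl; rewrite !cycle_infE !modn_small // -!(nth_map _ (cycle_base c)) //.
by move/eqP; rewrite nth_uniq ?size_map ?(cycle_uniq c) // => /eqP.
Qed.

Lemma cycle_start_at c f : f \in cycle_edges c ->
  exists d, rotation_of c d /\ first_edge d = f.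
Proof.
case/splitPr cE: {1}(cycle_edges c) / => [l1 l2].
have := cycle_walk c; have := cycle_closed c; have := cycle_uniq c.
rewrite -[first_edge c :: _]/(cycle_edges c) cE => uc ec wc.
have [w1 e1 w2 e2] := walk_to_edge wc; rewrite e2 in ec.
have wd : is_walk (src f) (f :: l2 ++ l1).
  by move: w2 => /= /andP[-> w2]; rewrite is_walk_cat w2 ec.
have ed : walk_end (src f) (f :: l2 ++ l1) = src f.
  by rewrite -cat_cons walk_end_cat -[walk_end _ (f :: l2)]/(walk_end (rng f) l2) ec.
have ud : uniq (map src (f :: l2 ++ l1)).
  by rewrite -cat_cons map_cat uniq_catC -map_cat.
exists (Cycle wd ed ud); split=> //; exists (size l1).
by rewrite cE rot_size_cat.
Qed.

(** The infinite path determines the length of the cycle: if one cycle were shorter, its length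
    would be a position at which the longer one returns to its base too early. *)
Lemma cycle_inf_eq c d : (forall k, cycle_inf c k = cycle_inf d k) ->
  cycle_edges c = cycle_edges d.
Proof.
move=> cd; have le c1 d1 : (forall k, cycle_inf c1 k = cycle_inf d1 k) ->
    (size (cycle_edges d1) <= size (cycle_edges c1))%N.
  move=> cd1; rewrite leqNgt; apply/negP => lt.
  suff : size (cycle_edges c1) = 0%N by [].
  apply: (@cycle_src_inj d1) => //.
  by rewrite -!cd1 !cycle_infE modnn mod0n.
have sE : size (cycle_edges c) = size (cycle_edges d).
  by apply/eqP; rewrite eqn_leq !le // => k; rewrite cd.
rewrite -(cycle_inf_prefix c) -(cycle_inf_prefix d) sE.
exact: eq_mkseq.
Qed.

Lemma maximal_cycle_walk c l i : maximal_cycle c ->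
  is_walk (src (cycle_inf c i)) l ->
  reaches (walk_end (src (cycle_inf c i)) l) (cycle_base c) ->
  l = mkseq (fun k => cycle_inf c (i + k)%N) (size l).
Proof.
move=> cmax; elim: l i => [|e l IH] i // wl el.
have /andP[/eqP es wl'] := wl.
have ec : reaches (rng e) (cycle_base c).
  by apply: reaches_trans el; apply/reachesP; exists l.
have ei : e = cycle_inf c i.
  by apply: (maximal_cycle_unique_edge cmax) ec => //; exact: cycle_inf_mem.
have ri : rng e = src (cycle_inf c i.+1) by rewrite ei iedgeP.
transitivity (cycle_inf c (i + 0)%N ::
    [seq cycle_inf c (i + k)%N | k <- iota (1 + 0) (size l)]); last by [].
rewrite addn0 -ei iotaDl -map_comp; congr (_ :: _).
rewrite ri in wl' ec; rewrite {1}(IH i.+1 wl'); last by rewrite -ri.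
by apply: eq_map => k; rewrite addSnnS.
Qed.

(** The walk has to follow [c^oo], and its end vertex determines its length modulo the length of
    [c], because the sources on [c] are distinct. *)
Lemma maximal_cycle_closed_walk c l : maximal_cycle c ->
  is_walk (cycle_base c) l -> walk_end (cycle_base c) l = cycle_base c ->
  exists k, l = flatten (nseq k (cycle_edges c)).
Proof.
move=> cmax wl el; have b0 : src (cycle_inf c 0) = cycle_base c.
  exact: asource_cycle_inf.
have lE := @maximal_cycle_walk c l 0 cmax.
rewrite b0 el in lE; have {}lE := lE wl (reaches_refl _).
set n := size (cycle_edges c); have n0 : (0 < n)%N by [].
have [_] := ipath_walk (cycle_inf c) (size l).
rewrite -{1}lE b0 el cycle_infE => s0.
have dv : (size l %% n = 0)%N.
  apply: (@cycle_src_inj c); rewrite ?ltn_mod // b0 s0 cycle_infE.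
  by rewrite modn_mod.
exists (size l %/ n)%N; rewrite {1}lE {1}(divn_eq (size l) n) dv addn0.
elim: (size l %/ n)%N => [|k IH] //.
rewrite -[RHS]/(cycle_edges c ++ flatten (nseq k (cycle_edges c))).
rewrite mulSn /mkseq iotaD map_cat -IH; congr (_ ++ _).
  exact: cycle_inf_prefix.
rewrite add0n -[X in iota X]addn0 iotaDl -map_comp; apply: eq_map => j.
by rewrite -[RHS](cycle_inf_period c 1) mul1n.
Qed.

End CycleWalks.

(** * Modules over Leavitt path algebras *)

Section NUModuleLinear.
Variables (K : fieldType) (A : nualgType K) (M : numodule A).

Lemma mact_is_linear (a : A) : linear (mact a : M -> M).
Proof. by move=> k m n; rewrite actDr actZr. Qed.

HB.instance Definition _ (a : A) :=
  GRing.isLinear.Build K M M _ (mact a) (mact_is_linear a).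

Lemma act0l (m : M) : mact (0 : A) m = 0.
Proof. by rewrite -(scale0r (0 : A)) actZl scale0r. Qed.

End NUModuleLinear.

Section Generation.
Variables (K : fieldType) (E : graph).

Lemma lpa_gen_ind (P : lpa K E -> Prop) :
  P 0 -> (forall g, P (lpa_of K g)) -> (forall a b, P a -> P b -> P (a + b)) ->
  (forall k a, P a -> P (k *: a)) -> (forall a b, P a -> P b -> P (nmul a b)) ->
  forall a, P a.
Proof.
move=> P0 Pg PD PZ PM; elim/lpa_ind; elim=> //.
- by move=> t Pt u Pu; rewrite -lpaDE; exact: PD.
- by move=> k t Pt; rewrite -lpaZE; exact: PZ.
- by move=> t Pt u Pu; rewrite -lpaME; exact: PM.
Qed.

Variable M : numodule (lpa K E).
Implicit Types (m n : M) (e f : edge E) (v w : vertex E) (l : seq (edge E)).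

Definition vact v m : M := mact (lpa_of K (Vtx v)) m.
Definition eact e m : M := mact (lpa_of K (Edg e)) m.
Definition gact e m : M := mact (lpa_of K (Gst e)) m.
HB.instance Definition _ v :=
  GRing.isLinear.Build K M M _ (vact v) (mact_is_linear _).
HB.instance Definition _ e :=
  GRing.isLinear.Build K M M _ (eact e) (mact_is_linear _).
HB.instance Definition _ e :=
  GRing.isLinear.Build K M M _ (gact e) (mact_is_linear _).

Definition walk_act l m : M := foldr eact m l.

Lemma walk_act_is_linear l : linear (walk_act l).
Proof. by elim: l => //= e l IH k m n; rewrite /= IH linearP. Qed.
HB.instance Definition _ l :=
  GRing.isLinear.Build K M M _ (walk_act l) (walk_act_is_linear l).

Lemma walk_act_cat l1 l2 m : walk_act (l1 ++ l2) m = walk_act l1 (walk_act l2 m).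
Proof. exact: foldr_cat. Qed.

Let rel (t u : lpa_term K E) m : lpa_eq t u -> mact (lpa_class t) m = mact (lpa_class u) m.
Proof. by move=> /lpa_classP ->. Qed.

Lemma vact_vact v m : vact v (vact v m) = vact v m.
Proof. by rewrite /vact -actM lpaME; apply/rel/rel_vv. Qed.

Lemma vact_neq v w m : v <> w -> vact v (vact w m) = 0.
Proof.
by move=> vw; rewrite /vact -actM lpaME (rel _ (rel_vw _ vw)) [LHS]act0l.
Qed.

Lemma vact_eact e m : vact (src e) (eact e m) = eact e m.
Proof. by rewrite /vact /eact -actM lpaME; apply/rel/rel_se. Qed.

Lemma eact_vact e m : eact e (vact (rng e) m) = eact e m.
Proof. by rewrite /vact /eact -actM lpaME; apply/rel/rel_er. Qed.

Lemma vact_gact e m : vact (rng e) (gact e m) = gact e m.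
Proof. by rewrite /vact /gact -actM lpaME; apply/rel/rel_rg. Qed.

Lemma gact_vact e m : gact e (vact (src e) m) = gact e m.
Proof. by rewrite /vact /gact -actM lpaME; apply/rel/rel_gs. Qed.

Lemma gact_eact e m : gact e (eact e m) = vact (rng e) m.
Proof. by rewrite /vact /eact /gact -actM lpaME; apply/rel/rel_ck1. Qed.

Lemma gact_eact_neq e f m : e <> f -> gact e (eact f m) = 0.
Proof.
by move=> ef; rewrite /gact /eact -actM lpaME (rel _ (rel_ck1' _ ef)) [LHS]act0l.
Qed.

Lemma vact_sum v l m : uniq l -> l <> [::] -> (forall e, e \in l <-> src e = v) ->
  vact v m = \sum_(e <- l) eact e (gact e m).
Proof.
move=> ul l0 lv; rewrite /vact (rel _ (rel_ck2 K ul l0 lv)).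
elim: l {ul l0 lv} => [|e l IH]; first by rewrite big_nil [LHS]act0l.
rewrite big_cons -IH /eact /gact -actM -actDl.
by rewrite lpaME lpaDE.
Qed.

(* [m] lies in the component [v M] of [M] when [vact v m = m]. *)
Lemma vact_other v w m : vact w m = m -> v <> w -> vact v m = 0.
Proof. by move=> <- /vact_neq. Qed.

Lemma eact_other e v m : vact v m = m -> v <> rng e -> eact e m = 0.
Proof. by move=> vm ve; rewrite -eact_vact (vact_other vm) ?linear0; last by move/esym. Qed.

Lemma gact_other e v m : vact v m = m -> v <> src e -> gact e m = 0.
Proof. by move=> vm ve; rewrite -gact_vact (vact_other vm) ?linear0; last by move/esym. Qed.

Lemma vact_walk v l m : is_walk v l -> vact (walk_end v l) m = m ->
  vact v (walk_act l m) = walk_act l m.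
Proof. by case: l => [|e l] //= /andP[/eqP <- _] _; exact: vact_eact. Qed.

(** The action of [l^*]: the ghost of the first edge acts first, which makes it a left inverse of
    [walk_act l]. *)
Fixpoint ghost_act l m : M := if l is e :: l' then ghost_act l' (gact e m) else m.

Lemma ghost_act_is_linear l : linear (ghost_act l).
Proof. by elim: l => //= e l IH k m n; rewrite linearP IH. Qed.
HB.instance Definition _ l :=
  GRing.isLinear.Build K M M _ (ghost_act l) (ghost_act_is_linear l).

Lemma ghost_walk v l m : is_walk v l -> vact (walk_end v l) m = m ->
  ghost_act l (walk_act l m) = m.
Proof.
elim: l v => [|e l IH] v //= /andP[_ wl] vm.
by rewrite gact_eact (vact_walk wl vm) (IH (rng e)).
Qed.

Lemma walk_act_inj v l m : is_walk v l -> vact (walk_end v l) m = m ->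
  walk_act l m = 0 -> m = 0.
Proof. by move=> wl vm m0; rewrite -(ghost_walk wl vm) m0 linear0. Qed.

Lemma submodule_walk (S : set M) l m : submodule S -> S m -> S (walk_act l m).
Proof. by case=> _ _ _ Sa Sm; elim: l => //= e l; exact: Sa. Qed.

Lemma submodule_ghost (S : set M) l m : submodule S -> S m -> S (ghost_act l m).
Proof. by case=> _ _ _ Sa; elim: l m => //= e l IH m Sm; apply/IH/Sa. Qed.

Lemma vertex_component m : m <> 0 -> exists v, vact v m <> 0.
Proof.
move=> m0; apply: contrapT => nv; apply: m0.
have vm v : vact v m = 0 by apply: contrapT => h; apply: nv; exists v.
have [s mE] := act_vertex_span m.
(* The sum of the finitely many vertices in an expression of [m] is an idempotent fixing [m];
   duplicates must go for it to be one. *)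
pose vs := undup (map fst s).
have : m = \sum_(v <- vs) vact v m.
  rewrite {1 2}mE; under [RHS]eq_bigr do rewrite linear_sum.
  rewrite exchange_big /=; apply: eq_big_seq => x xs.
  have xv : x.1 \in vs by rewrite mem_undup map_f.
  rewrite (bigD1_seq x.1) ?undup_uniq //= -/(vact _ _) vact_vact big1 ?addr0 //.
  by move=> v /eqP vx; rewrite -/(vact _ _) vact_neq.
by rewrite big1.
Qed.

End Generation.

(** * Isomorphisms of simple modules from a relation at one vertex *)

Section SimpleIso.
Variables (K : fieldType) (E : graph) (M N : numodule (lpa K E)).
Hypotheses (simM : simple_module M) (simN : simple_module N).
Variables (v : vertex E) (P : M -> N -> Prop).
Hypotheses (P0 : P 0 0) (PD : forall x y x' y', P x y -> P x' y' -> P (x + x') (y + y')).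
Hypothesis PZ : forall k x y, P x y -> P (k *: x) (k *: y).
Hypothesis Pv : forall x y, P x y -> vact v x = x /\ vact v y = y.
Hypotheses (Pl : forall y, P 0 y -> y = 0) (Pr : forall x, P x 0 -> x = 0).
Hypothesis Pn : exists x y, P x y /\ x <> 0.
Hypothesis Pwalk : forall l x y, is_walk v l -> walk_end v l = v -> P x y ->
  P (walk_act l x) (walk_act l y).

(* The graph of the isomorphism is the submodule of [M * N] generated by [P]. *)
Inductive graph_span : M -> N -> Prop :=
  | Span0 : graph_span 0 0
  | SpanD x y x' y' : graph_span x y -> graph_span x' y' -> graph_span (x + x') (y + y')
  | SpanW u l x y : is_walk u l -> walk_end u l = v -> P x y ->
      graph_span (walk_act l x) (walk_act l y).

(** On a nonempty walk a ghost edge cancels the first edge or gives [0], so only its effect on [P]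
    itself has to be assumed. At a sink the assumption is vacuous; on a cycle it holds because [c]
    acts invertibly on the pairs in [P]. *)
Hypothesis Pghost : forall e x y, src e = v -> P x y -> graph_span (gact e x) (gact e y).

Lemma graph_spanZ k x y : graph_span x y -> graph_span (k *: x) (k *: y).
Proof.
elim=> [|a b a' b' _ IH _ IH'|u l a b wl el Pab].
- by rewrite !scaler0; exact: Span0.
- by rewrite !scalerDr; exact: SpanD.
- by rewrite -!linearZ; apply: (SpanW wl el); exact: PZ.
Qed.

Lemma graph_span_vact w x y : graph_span x y -> graph_span (vact w x) (vact w y).
Proof.
elim=> [|a b a' b' _ IH _ IH'|u l a b wl el Pab].
- by rewrite !linear0; exact: Span0.
- by rewrite !linearD; exact: SpanD.
have [va vb] := Pv Pab; rewrite -el in va vb.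
have [<-|/eqP uw] := eqVneq u w.
  by rewrite !(vact_walk wl) //; exact: SpanW wl el Pab.
rewrite (@vact_other _ _ _ w u) ?(vact_walk wl) //; last by move/esym.
rewrite (@vact_other _ _ _ w u) ?(vact_walk wl) //; last by move/esym.
exact: Span0.
Qed.

Lemma graph_span_eact e x y : graph_span x y -> graph_span (eact e x) (eact e y).
Proof.
elim=> [|a b a' b' _ IH _ IH'|u l a b wl el Pab].
- by rewrite !linear0; exact: Span0.
- by rewrite !linearD; exact: SpanD.
have [va vb] := Pv Pab; rewrite -el in va vb.
have [ue|/eqP ue] := eqVneq u (rng e).
  have we : is_walk (src e) (e :: l) by rewrite /= eqxx -ue.
  by apply: (SpanW we _ Pab); rewrite -el ue.
rewrite (@eact_other _ _ _ e u) ?(vact_walk wl) //.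
rewrite (@eact_other _ _ _ e u) ?(vact_walk wl) //.
exact: Span0.
Qed.

Lemma graph_span_gact e x y : graph_span x y -> graph_span (gact e x) (gact e y).
Proof.
elim=> [|a b a' b' _ IH _ IH'|u l a b wl el Pab].
- by rewrite !linear0; exact: Span0.
- by rewrite !linearD; exact: SpanD.
have [va vb] := Pv Pab; rewrite -el in va vb.
case: l wl el va vb => [|f l] /= wl el va vb.
  have [ev|/eqP ev] := eqVneq (src e) v; first exact: Pghost.
  have ue : u <> src e by rewrite -[u]/(walk_end u [::]) el; exact/nesym.
  rewrite (gact_other va ue) (gact_other vb ue).
  exact: Span0.
case/andP: wl => _ wl.
have [->|/eqP ef] := eqVneq e f; last first.
  by rewrite !gact_eact_neq //; exact: Span0.
by rewrite !gact_eact !(vact_walk wl) //; exact: SpanW wl el Pab.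
Qed.

(** At the vertex [v] the span contains nothing beyond [P], since walks from [v] to [v] preserve
    [P]. This keeps the span from being all of [M * N]. *)
Lemma graph_span_corner x y : graph_span x y -> P (vact v x) (vact v y).
Proof.
elim=> [|a b a' b' _ IH _ IH'|u l a b wl el Pab].
- by rewrite !linear0.
- by rewrite !linearD; exact: PD.
have [va vb] := Pv Pab; rewrite -el in va vb.
have [uv|/eqP uv] := eqVneq u v; last first.
  rewrite (@vact_other _ _ _ v u) ?(vact_walk wl) //; last by move/esym.
  by rewrite (@vact_other _ _ _ v u) ?(vact_walk wl) //; last by move/esym.
by subst u; rewrite !(vact_walk wl) //; exact: Pwalk.
Qed.

Lemma graph_span_mact a x y : graph_span x y -> graph_span (mact a x) (mact a y).
Proof.
elim/lpa_gen_ind: a x y => [|[w|e|e]|a b IHa IHb|k a IHa|a b IHa IHb] x y Dxy.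
- by rewrite !act0l; exact: Span0.
- exact: graph_span_vact.
- exact: graph_span_eact.
- exact: graph_span_gact.
- by rewrite !actDl; apply: SpanD; [exact: IHa|exact: IHb].
- by rewrite !actZl; apply: graph_spanZ; exact: IHa.
- by rewrite !actM; apply/IHa/IHb.
Qed.

(** The fibre over [0] is a submodule of [N]. If it were everything, it would contain the second
    entry of a pair in [P] with nonzero first entry; the corner forces that second entry to be [0],
    and then [Pr] gives a contradiction. *)
Lemma graph_span_r y : graph_span 0 y -> y = 0.
Proof.
move=> D0y.
have sub : submodule [set z : N | graph_span 0 z]%classic.
  split=> /= [|m n Dm Dn|k m Dm|a m Dm].
  - exact: Span0.
  - by rewrite -[0]addr0; exact: SpanD.
  - by rewrite -(scaler0 _ k); exact: graph_spanZ.
  - by rewrite -(linear0 (mact a : {linear M -> M})); exact: graph_span_mact.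
case: (simN.2 _ sub) => [S0|ST].
  have : [set z : N | graph_span 0 z]%classic y by [].
  by rewrite S0.
have [x [z [Pxz x0]]] := Pn; case: x0; apply: Pr.
have : [set t : N | graph_span 0 t]%classic z by rewrite ST.
by move/graph_span_corner; rewrite linear0 (Pv Pxz).2 => /Pl <-.
Qed.

Lemma graph_span_l x : graph_span x 0 -> x = 0.
Proof.
move=> Dx0.
have sub : submodule [set z : M | graph_span z 0]%classic.
  split=> /= [|m n Dm Dn|k m Dm|a m Dm].
  - exact: Span0.
  - by rewrite -[0]addr0; exact: SpanD.
  - by rewrite -(scaler0 _ k); exact: graph_spanZ.
  - by rewrite -(linear0 (mact a : {linear N -> N})); exact: graph_span_mact.
case: (simM.2 _ sub) => [S0|ST].
  have : [set z : M | graph_span z 0]%classic x by [].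
  by rewrite S0.
have [z [y [Pzy z0]]] := Pn; case: z0.
have : [set t : M | graph_span t 0]%classic z by rewrite ST.
by move/graph_span_corner; rewrite linear0 (Pv Pzy).1 => /Pr.
Qed.

Lemma graph_span_total x : exists y, graph_span x y.
Proof.
have sub : submodule [set z : M | exists y, graph_span z y]%classic.
  split=> /= [|m n [y Dm] [y' Dn]|k m [y Dm]|a m [y Dm]].
  - by exists 0; exact: Span0.
  - by exists (y + y'); exact: SpanD.
  - by exists (k *: y); exact: graph_spanZ.
  - by exists (mact a y); exact: graph_span_mact.
case: (simM.2 _ sub) => [S0|ST]; last first.
  by have : [set z : M | exists y, graph_span z y]%classic x by rewrite ST.
have [z [y [Pzy z0]]] := Pn; case: z0.
have : [set t : M | exists y, graph_span t y]%classic z.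
  by exists y; exact: (@SpanW v [::]).
by rewrite S0.
Qed.

Lemma graph_span_onto y : exists x, graph_span x y.
Proof.
have sub : submodule [set z : N | exists x, graph_span x z]%classic.
  split=> /= [|m n [x Dm] [x' Dn]|k m [x Dm]|a m [x Dm]].
  - by exists 0; exact: Span0.
  - by exists (x + x'); exact: SpanD.
  - by exists (k *: x); exact: graph_spanZ.
  - by exists (mact a x); exact: graph_span_mact.
case: (simN.2 _ sub) => [S0|ST]; last first.
  by have : [set z : N | exists x, graph_span x z]%classic y by rewrite ST.
have [x [z [Pxz x0]]] := Pn; case: x0; apply: Pr.
have : [set t : N | exists x, graph_span x t]%classic z.
  by exists x; exact: (@SpanW v [::]).
by rewrite S0 => /= <-.
Qed.

Lemma simple_module_iso : module_iso M N.
Proof.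
have [phi phiP] := choice graph_span_total.
have uniq_r x y y' : graph_span x y -> graph_span x y' -> y = y'.
  move=> D D'; apply/eqP; rewrite -subr_eq0; apply/eqP/graph_span_r.
  by rewrite -(subrr x) -!scaleN1r; apply/SpanD => //; exact: graph_spanZ.
have uniq_l x x' y : graph_span x y -> graph_span x' y -> x = x'.
  move=> D D'; apply/eqP; rewrite -subr_eq0; apply/eqP/graph_span_l.
  by rewrite -(subrr y) -!scaleN1r; apply/SpanD => //; exact: graph_spanZ.
have lin : linear phi.
  move=> k x y; apply: uniq_r (phiP _) _.
  by apply: SpanD => //; exact: graph_spanZ.
pose phiL := HB.pack phi (GRing.isLinear.Build K M N _ phi lin) : {linear M -> N}.
exists phiL; split.
  have [psi psiP] := choice graph_span_onto.
  exists psi => [x|y] /=; first exact: uniq_l (psiP _) (phiP _).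
  exact: uniq_r (phiP _) (psiP _).
by move=> a m; apply: uniq_r (phiP _) _; exact/graph_span_mact/phiP.
Qed.

End SimpleIso.

(** * Polynomials in an endomorphism *)

Section PolyAct.
Variables (K : fieldType) (V : lmodType K) (T : {linear V -> V}).
Implicit Types (p q f : {poly K}) (x : V).

Definition poly_act p x : V := \sum_(i < size p) p`_i *: iter i T x.

Lemma iter_is_linear i : linear (iter i T).
Proof. by elim: i => //= i IH k x y; rewrite /= IH linearP. Qed.
HB.instance Definition _ i := GRing.isLinear.Build K V V _ (iter i T) (iter_is_linear i).

Lemma poly_act_is_linear p : linear (poly_act p).
Proof.
move=> k x y; rewrite /poly_act scaler_sumr -big_split; apply: eq_bigr => i _.
by rewrite linearP scalerDr !scalerA mulrC.
Qed.
HB.instance Definition _ p :=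
  GRing.isLinear.Build K V V _ (poly_act p) (poly_act_is_linear p).

Lemma poly_actEw n p x : (size p <= n)%N ->
  poly_act p x = \sum_(i < n) p`_i *: iter i T x.
Proof.
move=> pn; rewrite /poly_act (big_ord_widen n (fun i => p`_i *: iter i T x) pn).
rewrite big_mkcond /=; apply: eq_bigr => i _; case: ltnP => // ip.
by rewrite nth_default // scale0r.
Qed.

Lemma poly_actD p q x : poly_act (p + q) x = poly_act p x + poly_act q x.
Proof.
rewrite (poly_actEw _ (size_polyD p q)) (poly_actEw _ (leq_maxl (size p) (size q))).
rewrite (poly_actEw _ (leq_maxr (size p) (size q))) -big_split; apply: eq_bigr => i _.
by rewrite coefD scalerDl.
Qed.

Lemma poly_actC k x : poly_act k%:P x = k *: x.
Proof. by rewrite (poly_actEw _ (size_polyC_leq1 k)) big_ord1 coefC. Qed.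

Lemma poly_act_mulX p x : poly_act (p * 'X) x = poly_act p (T x).
Proof.
have sp : (size (p * 'X)%R <= (size p).+1)%N.
  by rewrite (leq_trans (size_polyMleq _ _)) // size_polyX addn2.
rewrite (poly_actEw _ sp) big_ord_recl coefMX scale0r add0r.
by apply: eq_bigr => i _; rewrite coefMX /= -iterSr.
Qed.

Lemma poly_act0 x : poly_act 0 x = 0.
Proof. by rewrite -polyC0 poly_actC scale0r. Qed.

Lemma poly_act1 x : poly_act 1 x = x.
Proof. by rewrite -polyC1 poly_actC scale1r. Qed.

Lemma poly_actX x : poly_act 'X x = T x.
Proof. by rewrite -['X]mul1r poly_act_mulX poly_act1. Qed.

Lemma poly_act_comm p x : poly_act p (T x) = T (poly_act p x).
Proof.
rewrite /poly_act linear_sum; apply: eq_bigr => i _.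
by rewrite linearZ -iterSr.
Qed.

Lemma poly_actZ k p x : poly_act (k *: p) x = k *: poly_act p x.
Proof.
rewrite (poly_actEw _ (size_scale_leq k p)) scaler_sumr; apply: eq_bigr => i _.
by rewrite coefZ scalerA.
Qed.

Lemma poly_actM p q x : poly_act (p * q) x = poly_act p (poly_act q x).
Proof.
elim/poly_ind: p x => [|p k IH] x; first by rewrite mul0r !poly_act0.
rewrite mulrDl !poly_actD mulrAC !poly_act_mulX IH poly_act_comm.
by rewrite mul_polyC poly_actZ poly_actC.
Qed.

(** The annihilator of a nonzero vector is a proper ideal; containing an irreducible [f], it is
    generated by [f]. *)
Lemma poly_act_eq0 f g x : irreducible_poly f -> poly_act f x = 0 -> x <> 0 ->
  (poly_act g x = 0 <-> f %| g).
Proof.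
move=> irrf fx x0; split=> [gx|/dvdpP[q ->]]; last by rewrite poly_actM fx linear0.
apply: contrapT => /negP nfg; apply: x0.
have /Bezout_eq1_coprimepP[[u w] /= uw] : coprimep f g.
  by rewrite irreducible_poly_coprime.
by rewrite -(poly_act1 x) -uw poly_actD !poly_actM fx gx !linear0 addr0.
Qed.

End PolyAct.

(** * Linear algebra in finite dimension *)

Section FiniteDim.
Variables (K : fieldType) (V : lmodType K) (n : nat) (ax : Vector.axiom n V).

Lemma linear_dependence k (x : 'I_k -> V) : (n < k)%N ->
  exists u : 'I_k -> K, (exists i, u i != 0) /\ \sum_i u i *: x i = 0.
Proof.
have [v2r lin /bij_inj inj] := ax.
pose v2rL := HB.pack v2r (GRing.isLinear.Build K V 'rV[K]_n _ v2r lin)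
  : {linear V -> 'rV[K]_n}.
move=> nk; pose A := \matrix_(i < k) v2r (x i).
have [|] := boolP (row_free A).
  by rewrite /row_free => /eqP rA; have := rank_leq_col A; rewrite rA leqNgt nk.
rewrite -kermx_eq0 => /rowV0Pn[u /sub_kermxP uA u0].
exists (u 0); split.
  by have /rV0Pn[i ui] := u0; exists i.
apply: inj; transitivity (u *m A); last first.
  by rewrite uA -[RHS]/(v2rL 0) linear0.
rewrite -[LHS]/(v2rL _) linear_sum mulmx_sum_row; apply: eq_bigr => i _.
by rewrite linearZ rowK.
Qed.

Lemma injective_surjective (f : {linear V -> V}) :
  (forall x, f x = 0 -> x = 0) -> forall y, exists x, f x = y.
Proof.
move=> f0 y; have [v2r lin [r2v v2rK r2vK]] := ax.
pose v2rL := HB.pack v2r (GRing.isLinear.Build K V 'rV[K]_n _ v2r lin)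
  : {linear V -> 'rV[K]_n}.
have r2v_lin : linear r2v := can2_linear (f := v2rL) v2rK r2vK.
pose r2vL := HB.pack r2v (GRing.isLinear.Build K 'rV[K]_n V _ r2v r2v_lin)
  : {linear 'rV[K]_n -> V}.
pose A := lin1_mx (v2rL \o (f \o r2vL)).
have Au : A \in unitmx.
  rewrite -row_free_unit; apply: inj_row_free => u; rewrite mul_rV_lin1 /= => fu.
  have : v2rL (f (r2v u)) = v2rL 0 by rewrite linear0.
  move=> /(can_inj v2rK) /f0 /(congr1 v2r); rewrite r2vK => ->.
  by rewrite -[v2r 0]/(v2rL 0) linear0.
exists (r2v (v2r y *m invmx A)); apply: (can_inj v2rK).
by rewrite -[LHS]/((v2rL \o (f \o r2vL)) _) -mul_rV_lin1 mulmxKV.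
Qed.

End FiniteDim.

Lemma submodule_poly (K : fieldType) (E : graph) (M : numodule (lpa K E)) (S : set M)
    l g m : submodule S -> S m -> S (poly_act (walk_act (M:=M) l) g m).
Proof.
move=> subS Sm; have [S0 SD SZ _] := subS.
rewrite /poly_act; elim/big_ind: _ => // i _; apply: SZ.
by elim: (nat_of_ord i) => //= j; exact: submodule_walk.
Qed.

Lemma vact_poly (K : fieldType) (E : graph) (M : numodule (lpa K E)) v l g (m : M) :
  is_walk v l -> walk_end v l = v -> vact v m = m ->
  vact v (poly_act (walk_act l) g m) = poly_act (walk_act l) g m.
Proof.
move=> wl el vm; rewrite /poly_act linear_sum; apply: eq_bigr => i _.
rewrite linearZ /=; congr (_ *: _); elim: (nat_of_ord i) => // j IH.
by apply: vact_walk; rewrite ?el.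
Qed.

(** * Finite-dimensional modules *)

Section FiniteDimModule.
Variables (K : fieldType) (E : graph) (M : numodule (lpa K E)).
Hypothesis fd : finite_dimensional M.
Implicit Types (m x y : M) (e f : edge E) (u v w : vertex E) (l : seq (edge E)).

Definition supports v := exists m, vact v m = m /\ m <> 0.

Lemma supports_reaches u v : reaches u v -> supports v -> supports u.
Proof.
move=> /reachesP[l [wl <-]] [m [vm m0]]; exists (walk_act l m).
by split; [exact: vact_walk|move=> /(walk_act_inj wl vm)].
Qed.

(** Nonzero vectors taken from different components are linearly independent: applying one vertex to
    a linear relation isolates one coefficient. *)
Lemma finite_support : finite_set [set v | supports v]%classic.
Proof.
have [n [ax]] := fd.
apply: contrapT => /(infinite_set_fset n.+1)[B BS Bn].
have lt : (n < size (enum_fset B))%N by [].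
have /choice[x xP] (i : 'I_(size (enum_fset B))) :
    exists m, vact (tnth (in_tuple (enum_fset B)) i) m = m /\ m <> 0.
  by apply: BS; exact: mem_tnth.
have [c [[i ci] cx]] := linear_dependence ax x lt.
have := congr1 (vact (tnth (in_tuple (enum_fset B)) i)) cx.
rewrite linear0 linear_sum (bigD1 i) //= linearZ /= (xP i).1 big1 ?addr0.
  by move/eqP; rewrite scaler_eq0 (negbTE ci) => /eqP/(xP i).2.
move=> j ji; rewrite linearZ /= (vact_other (xP j).1) ?scaler0 // => ij.
move: ji; rewrite -(inj_eq val_inj) /=.
have v0 : vertex E := tnth (in_tuple (enum_fset B)) i.
move/eqP: ij; rewrite !(tnth_nth v0) /=.
by rewrite nth_uniq ?fset_uniq // eq_sym => /eqP ->; rewrite eqxx.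
Qed.

Lemma closed_walk_onto v l x : is_walk v l -> walk_end v l = v -> vact v x = x ->
  exists y, vact v y = y /\ walk_act l y = x.
Proof.
move=> wl el vx; have [n [ax]] := fd.
(* [T] is the walk on [v M] and the identity on the complement, so that the argument runs on all of
   [M] and not on a subspace. *)
pose T y := walk_act l (vact v y) + (y - vact v y).
have lin : linear T.
  move=> k y z; rewrite /T (linearP (vact v)) (linearP (walk_act l)) /=.
  by rewrite scalerDr scalerBr opprD [RHS]addrACA; congr (_ + _); rewrite addrACA.
pose TL := HB.pack T (GRing.isLinear.Build K M M _ T lin) : {linear M -> M}.
have Tv y : vact v (T y) = walk_act l (vact v y).
  rewrite /T linearD linearB /= vact_vact subrr addr0.
  by apply: vact_walk => //; rewrite el vact_vact.
have [|y Ty] := @injective_surjective _ _ _ ax TL _ x.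
  move=> y Ty; have := Tv y; rewrite -[T y]/(TL y) Ty linear0 => /esym vy.
  have {}vy : vact v y = 0.
    by apply: (walk_act_inj wl) vy; rewrite el vact_vact.
  by move: Ty; rewrite /= /T vy linear0 add0r subr0.
by exists (vact v y); rewrite vact_vact -Tv -[T y]/(TL y) Ty vx.
Qed.

(** With [l = l1 f l2], surjectivity of [l] gives [l1 (e m) = l1 (f (l2 y))] for any [m] at [rng e].
    Cancelling [l1] and applying the ghost of [e] leaves [m = 0] when [e] differs from [f]. *)
Lemma closed_walk_exit v l e f : is_walk v l -> walk_end v l = v -> f \in l ->
  src e = src f -> supports (rng e) -> e = f.
Proof.
move=> wl el fl ef [m [em m0]]; apply: contrapT => nef; apply: m0.
case/splitPr: fl wl el => l1 l2 wl el.
have [w1 e1 w2 _] := walk_to_edge wl.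
have vx : vact v (walk_act l1 (eact e m)) = walk_act l1 (eact e m).
  by apply: vact_walk => //; rewrite e1 -ef vact_eact.
have [y [vy]] := closed_walk_onto wl el vx.
rewrite walk_act_cat => /(congr1 (ghost_act l1)).
rewrite !(ghost_walk w1) ?e1 -?ef ?vact_eact //=; last by rewrite ef vact_eact.
by move/(congr1 (gact e)); rewrite gact_eact_neq // gact_eact em => /esym.
Qed.

Lemma closed_walk_eigen v l : is_walk v l -> walk_end v l = v -> supports v ->
  exists (f : {poly K}) m,
    [/\ irreducible_poly f, f \is monic, f != 'X, vact v m = m & m <> 0] /\
    poly_act (walk_act (M:=M) l) f m = 0.
Proof.
move=> wl el [m0 [vm0 m00]]; have [n [ax]] := fd.
pose T : {linear M -> M} := walk_act l.
(* The size is minimized over the polynomials and over the vectors at once. Then a divisor [q] of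
   [p = r q] either kills [m], or [r] kills the nonzero vector [q m]; in both cases minimality
   applies, and [p] is irreducible. *)
pose Q k := exists (p : {poly K}) m,
  [/\ size p = k, p != 0, vact v m = m, m <> 0 & poly_act T p m = 0].
have exQ : exists k, `[< Q k >].
  have [c [[i ci] cx]] := linear_dependence ax (fun i : 'I_n.+1 => iter i T m0) (ltnSn n).
  pose p := \poly_(i < n.+1) c (inord i).
  exists (size p); apply/asboolP; exists p, m0; split=> //.
    apply/eqP => /(congr1 (fun q : {poly K} => q`_i)) /eqP.
    by rewrite coef_poly ltn_ord coef0 inord_val (negbTE ci).
  rewrite (poly_actEw _ _ (size_poly _ _)) -[RHS]cx; apply: eq_bigr => j _.
  by rewrite coef_poly ltn_ord inord_val.
case: (ex_minnP exQ) => k /asboolP[p [m [pk p0 vm nm pm]]] kmin.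
have {}kmin q x : q != 0 -> vact v x = x -> x <> 0 -> poly_act T q x = 0 ->
    (size p <= size q)%N.
  by move=> q0 vx x0 qx; rewrite pk; apply/kmin/asboolP; exists q, x.
have p1 : (1 < size p)%N.
  rewrite ltnNge; apply/negP => /size1_polyC pc.
  move: pm p0; rewrite pc poly_actC polyC_eq0 => /eqP; rewrite scaler_eq0.
  by case/orP=> [->|/eqP].
have irr : irreducible_poly p.
  split=> // q q1 qp; rewrite -dvdp_size_eqp // eqn_leq dvdp_leq //.
  have q0 : q != 0 by apply: contra_neq p0 => q0; move: qp; rewrite q0 => /dvd0pP.
  have [r pE] := dvdpP _ _ qp.
  have [qm|/eqP qm] := eqVneq (poly_act T q m) 0; first exact: kmin qm.
  have r0 : r != 0 by apply: contra_neq p0; rewrite pE => ->; rewrite mul0r.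
  have pr : (size p <= size r)%N.
    by apply: (kmin _ (poly_act T q m)) => //; [exact: vact_poly|rewrite -poly_actM -pE].
  have : (size p = (size r + size q).-1)%N by rewrite pE size_mul.
  move: q1 q0; rewrite -size_poly_gt0 => /eqP; lia.
exists ((lead_coef p)^-1 *: p), m; split; last by rewrite poly_actZ pm scaler0.
have lp : (lead_coef p)^-1 != 0 by rewrite invr_eq0 lead_coef_eq0.
split=> //.
- split; first by rewrite size_scale.
  by move=> q q1; rewrite dvdpZr // => /(irr.2 _ q1) qp; rewrite (eqp_trans qp) // eqp_sym eqp_scale.
- by rewrite monicE lead_coefZ mulVf // lead_coef_eq0.
(* A vector killed by ['X] is killed by the walk, which acts injectively. *)
- apply/eqP => pX; apply: nm; apply: (walk_act_inj wl); first by rewrite el.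
  by rewrite -[LHS](poly_actX T) -pX poly_actZ pm scaler0.
Qed.

Lemma supports_edge v : row_finite E -> ~ is_sink v -> supports v ->
  exists e, src e = v /\ supports (rng e).
Proof.
move=> hE nsv [m [vm m0]]; have [s sE] := (finite_seqP _).1 (hE v).
have lv e : e \in undup s <-> src e = v.
  rewrite mem_undup; split=> h.
    by have : [set e | src e = v]%classic e by rewrite sE.
  by have : [set e | src e = v]%classic e by []; rewrite sE.
have l0 : undup s <> [::].
  by move=> s0; apply: nsv => e /lv; rewrite s0.
apply: contrapT => ne; apply: m0; rewrite -vm (vact_sum _ (undup_uniq s) l0 lv).
rewrite big_seq big1 // => e /lv ev.
suff -> : gact e m = 0 by rewrite linear0.
apply: contrapT => em; apply: ne; exists e; split=> //.
by exists (gact e m); rewrite vact_gact.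
Qed.

(** Without sinks a walk can be continued inside the support for ever; one edge more than the number
    of supporting vertices forces a repetition. *)
Lemma supports_cycle v : row_finite E -> supports v ->
  (forall w, supports w -> ~ is_sink w) -> exists c, supports (cycle_base c).
Proof.
move=> hE sv ns; have [s sE] := (finite_seqP _).1 finite_support.
have walks k u : supports u ->
    exists l, [/\ size l = k, is_walk u l & forall e, e \in l -> supports (src e)].
  elim: k u => [|k IH] u su; first by exists [::].
  have [e [eu se]] := supports_edge hE (ns _ su) su.
  have [l [lk wl ls]] := IH _ se; exists (e :: l); rewrite /= lk eu eqxx; split=> // f.
  by rewrite inE => /orP[/eqP ->|/ls//]; rewrite eu.
have [l [lk wl ls]] := walks (size s).+1 _ sv.
have nu : ~~ uniq (map src l).
  apply/negP => /uniq_leq_size -/(_ s).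
  rewrite size_map lk ltnn => h; suff : false by []; apply: h => w.
  case/mapP=> e el ->; have : [set v | supports v]%classic (src e) by exact: ls.
  by rewrite sE.
have [c [l1 [l2 lE]]] := walk_cycle wl nu.
by exists c; apply: ls; rewrite lE !mem_cat mem_first_edge orbT.
Qed.

End FiniteDimModule.

(** * Path modules with weighted edges *)

Lemma uniq_map_inj (T1 T2 : eqType) (g : T1 -> T2) (s : seq T1) x y :
  uniq (map g s) -> x \in s -> y \in s -> g x = g y -> x = y.
Proof.
elim: s => //= z s IH /andP[zs us]; rewrite !inE.
case/predU1P=> [->|xs] /predU1P[->|ys] // gxy; last exact: IH.
  by rewrite gxy map_f in zs.
by rewrite -gxy map_f in zs.
Qed.

(* [u k p] stands for the multiple [k p] of the basis path [p], so that [M] is an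
   [L]-vector space with basis [C] on which [e] acts by [p |-> a_e (e p)].  Both
   [V_[x]] and [V^f_[c^oo]] are of this form. *)
Record weighted_paths (K L : fieldType) (iota : {rmorphism K -> L}) (E : graph)
    (C : set (anypath E)) (a : edge E -> L) (M : numodule (lpa K E))
    (u : L -> anypath E -> M) : Prop := WeightedPaths {
  wpD : forall k h p, u (k + h) p = u k p + u h p;
  wpZ : forall c k p, u (iota c * k) p = c *: u k p;
  wp_span : forall m, exists s : seq (L * anypath E),
    [/\ uniq (map snd s), (forall x, x \in s -> C x.2) &
        m = \sum_(x <- s) u x.1 x.2];
  wp_free : forall s : seq (L * anypath E), uniq (map snd s) ->
    (forall x, x \in s -> C x.2) -> \sum_(x <- s) u x.1 x.2 = 0 ->
    forall x, x \in s -> x.1 = 0;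
  wp_vact : forall v k p, C p -> vact v (u k p) = if asource p == v then u k p else 0;
  wp_eact : forall e k p, C p -> asource p = rng e ->
    eact e (u k p) = u (a e * k) (pcons e p);
  wp_gact : forall e k p, C p ->
    gact e (u k p) = if pfirst p == Some e then u ((a e)^-1 * k) (ptail p) else 0
}.

Section WeightedPathModule.
Import VectorInternalTheory.
Variables (K L : fieldType) (iota : {rmorphism K -> L}) (E : graph).
Variables (C : set (anypath E)) (a : edge E -> L) (M : numodule (lpa K E)).
Variable u : L -> anypath E -> M.
Hypotheses (hC : path_closed C) (ha : forall e, a e != 0).
Hypothesis hu : weighted_paths iota C a u.
Implicit Types (p q : anypath E) (l : seq (edge E)) (v : vertex E) (k : L).

Lemma wp0 p : u 0 p = 0.
Proof. by apply: (addrI (u 0 p)); rewrite -(wpD hu) !addr0. Qed.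

Lemma wp_inj k p : C p -> u k p = 0 -> k = 0.
Proof.
move=> Cp k0; apply: (wp_free hu (s := [:: (k, p)]) _ _ _ (mem_head _ _)) => //.
  by move=> x; rewrite inE => /eqP ->.
by rewrite big_seq1.
Qed.

Lemma wp_vertex k p : C p -> vact (asource p) (u k p) = u k p.
Proof. by move=> Cp; rewrite (wp_vact hu) // eqxx. Qed.

Definition walk_weight l : L := \prod_(e <- l) a e.

Lemma walk_weight_neq0 l : walk_weight l != 0.
Proof. by rewrite prodf_seq_neq0; apply/allP => e _; rewrite ha. Qed.

Lemma wp_walk l v k p : C p -> is_walk v l -> walk_end v l = asource p ->
  walk_act l (u k p) = u (walk_weight l * k) (prepend l p).
Proof.
rewrite /walk_weight => Cp; elim: l v => [|e l IH] v /=; first by rewrite big_nil mul1r.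
move=> /andP[_ wl] el; rewrite (IH _ wl el) big_cons (wp_eact hu) ?mulrA //.
  exact: path_closed_prepend wl el.
exact: asource_prepend wl el.
Qed.

Lemma wp_ghost l v k p : C p -> is_walk v l -> asource p = v ->
  ghost_act l (u k p) = 0 \/
  exists q, [/\ C q, asource q = walk_end v l & p = prepend l q].
Proof.
elim: l v k p => [|e l IH] v k p Cp /=; first by right; exists p.
move=> /andP[_ wl] sp; rewrite (wp_gact hu) //.
case: eqP => [pe|_]; last by left; rewrite linear0.
have [[f [p' [pE sf Cp']]]|[w [pw _]]] := hC.2 p Cp; last by rewrite pw in pe.
move: pe; rewrite pE pfirst_pcons => -[fe]; subst f; rewrite ptail_pcons //.
have [->|[q [Cq sq qE]]] := IH _ ((a e)^-1 * k) p' Cp' wl sf; first by left.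
by right; exists q; split=> //; rewrite qE.
Qed.

Lemma wp_supports v : supports M v -> exists p, C p /\ asource p = v.
Proof.
move=> [m [vm m0]]; apply: contrapT => np; apply: m0; rewrite -vm.
have [s [_ sC ->]] := wp_span hu m.
rewrite linear_sum big_seq big1 // => x xs; rewrite /= (wp_vact hu); last exact: sC.
by case: eqP => // sx; case: np; exists x.2; split=> //; exact: sC.
Qed.

Section Base.
Variable p0 : anypath E.
Hypothesis Cp0 : C p0.
Hypothesis base_uniq : forall p, C p -> asource p = asource p0 -> p = p0.

Lemma wp_corner m : vact (asource p0) m = m -> exists k, m = u k p0.
Proof.
move=> <-; have [s [_ sC ->]] := wp_span hu m; rewrite linear_sum.
elim: s sC => [|x s IH] sC; first by exists 0; rewrite big_nil wp0.
rewrite big_cons; have [|k ->] := IH.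
  by move=> y ys; apply: sC; rewrite inE ys orbT.
have Cx : C x.2 by apply: sC; rewrite mem_head.
rewrite /= (wp_vact hu) //; case: eqP => [sx|_]; last by exists k; rewrite add0r.
by exists (x.1 + k); rewrite (base_uniq Cx sx) (wpD hu).
Qed.

Hypothesis base_prepend : forall p, C p -> exists l,
  [/\ is_walk (asource p) l, walk_end (asource p) l = asource p0 & p = prepend l p0].
(** The component at the base vertex must be simple under what acts on it: scalars of [K] at a sink,
    polynomials in [c] at a cycle. *)
Hypothesis base_cyclic : forall (S : set M) k h, submodule S -> k != 0 ->
  S (u k p0) -> S (u h p0).

Lemma wp_simple : simple_module M.
Proof.
split; first by exists (u 1 p0) => /(wp_inj Cp0)/eqP; rewrite oner_eq0.
move=> S subS; have [S0 SD SZ Sa] := subS.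
have [S1|] := pselect (forall m, S m -> m = 0).
  by left; apply/seteqP; split=> [m /S1 //|m /= ->].
move=> /existsNP[m /not_implyP[Sm m0]]; right.
have [s [us sC mE]] := wp_span hu m.
have [x xs x0] : exists2 x, x \in s & x.1 != 0.
  apply: contrapT => nx; apply: m0; rewrite mE big_seq big1 // => x xs.
  by have [->|x0] := eqVneq x.1 0; rewrite ?wp0 //; case: nx; exists x.
have Cx := sC _ xs; have [l [wl el xE]] := base_prepend Cx.
(* Stripping [l] from [m] isolates one term: a basis path that survives begins with [l], and what
   remains starts at the base, so it is [p0] and the path was [x.2]. The inverse weight compensates
   for the scalars picked up along [l]. *)
have Sb : S (u ((walk_weight l)^-1 * x.1) p0).
  have -> : u ((walk_weight l)^-1 * x.1) p0 = ghost_act l (vact (asource x.2) m).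
    rewrite {1}mE linear_sum linear_sum (bigD1_seq x) //=; last exact: map_uniq us.
    have {1}-> : u x.1 x.2 = walk_act l (u ((walk_weight l)^-1 * x.1) p0).
      by rewrite (wp_walk _ Cp0 wl) // mulVKf ?walk_weight_neq0 -?xE.
    rewrite (vact_walk wl) ?el ?wp_vertex // (ghost_walk wl) ?el ?wp_vertex //.
    rewrite big_seq_cond big1 ?addr0 // => y /andP[ys yx].
    have Cy := sC _ ys; rewrite (wp_vact hu) //; case: eqP => [sy|_]; last first.
      by rewrite linear0.
    have [//|[q [Cq sq qE]]] := wp_ghost y.1 Cy wl sy.
    have yx2 : y.2 = x.2 by rewrite qE xE (base_uniq Cq) // sq el.
    by rewrite (uniq_map_inj us ys xs yx2) eqxx in yx.
  by apply: submodule_ghost => //; exact: Sa.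
have Sk k : S (u k p0).
  apply: base_cyclic Sb => //.
  by rewrite mulf_neq0 // invr_eq0 walk_weight_neq0.
have Su k p : C p -> S (u k p).
  move=> Cp; have [l' [wl' el' ->]] := base_prepend Cp.
  have <- : walk_act l' (u ((walk_weight l')^-1 * k) p0) = u k (prepend l' p0).
    by rewrite (wp_walk _ Cp0 wl') // mulVKf ?walk_weight_neq0.
  exact: submodule_walk.
apply/seteqP; split=> // n _; have [t [_ tC ->]] := wp_span hu n.
elim: t tC => [|y t IH] tC; first by rewrite big_nil.
rewrite big_cons; apply: SD; first by apply: Su; apply: tC; rewrite mem_head.
by apply: IH => z zt; apply: tC; rewrite inE zt orbT.
Qed.

Lemma wp_poly l (g : {poly K}) k : is_walk (asource p0) l ->
  walk_end (asource p0) l = asource p0 ->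
  poly_act (walk_act (M:=M) l) g (u k p0) =
  u ((map_poly iota g).[walk_weight l] * k) p0.
Proof.
move=> wl el; have T h : walk_act l (u h p0) = u (walk_weight l * h) p0.
  rewrite (wp_walk _ Cp0 wl el); congr u; apply: base_uniq.
    exact: path_closed_prepend wl el.
  exact: asource_prepend wl el.
have Ti i h : iter i (walk_act l) (u h p0) = u (walk_weight l ^+ i * h) p0.
  by elim: i => [|i IH]; rewrite ?mul1r //= IH T mulrA exprS.
elim/poly_ind: g k => [|g c IH] k; first by rewrite poly_act0 rmorph0 horner0 mul0r wp0.
rewrite poly_actD poly_act_mulX poly_actC /= T IH rmorphD rmorphM /= map_polyX map_polyC.
by rewrite hornerMXaddC mulrDl (wpD hu) (wpZ hu) mulrA.
Qed.

End Base.

(** [W] stands for [L] viewed as a finite-dimensional [K]-space through [iota]; [theta] identifies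
    the two. *)
Lemma wp_finite_dimensional (W : vectType K) (theta : W -> L) :
  (forall c x y, theta (c *: x + y) = iota c * theta x + theta y) ->
  bijective theta -> finite_set C -> finite_dimensional M.
Proof.
move=> thl [theta' thK thK'] /(finite_seqP _)[s0 sE].
pose s := undup s0; have us : uniq s := undup_uniq s0.
have sC p : p \in s <-> C p.
  rewrite mem_undup sE; split; exact: id.
pose n := size s.
pose psi (h : {ffun 'I_n -> W}) : M := \sum_(i < n) u (theta (h i)) (tnth (in_tuple s) i).
have lin : linear psi.
  move=> c g h; rewrite /psi scaler_sumr -big_split; apply: eq_bigr => i _.
  by rewrite !ffunE thl (wpD hu) (wpZ hu).
pose psiL := HB.pack psi (GRing.isLinear.Build K {ffun 'I_n -> W} M _ psi lin)
  : {linear {ffun 'I_n -> W} -> M}.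
have Cs i : C (tnth (in_tuple s) i) by apply/sC/mem_tnth.
have th0 : theta 0 = 0.
  by have := thl (-1) 0 0; rewrite scaleN1r addNr rmorphN1 mulN1r addNr.
have inj : injective psiL.
  move=> g h /eqP; rewrite -subr_eq0 -linearB => /eqP /=; set d := g - h => d0.
  apply/eqP; rewrite -subr_eq0 -/d; apply/eqP/ffunP => i; rewrite [RHS]ffunE.
  apply: (can_inj thK); rewrite th0.
  pose t := [seq (theta (d j), tnth (in_tuple s) j) | j <- enum 'I_n].
  have tE : map snd t = s.
    by rewrite -map_comp; exact: (map_tnth_enum (in_tuple s)).
  apply: (wp_free hu (s := t) _ _ _ (map_f _ (mem_enum _ i))).
  - by rewrite tE.
  - by move=> x /mapP[j _ ->] /=.
  - by rewrite big_map big_enum.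
have surj m : exists h, psi h = m.
  have [t [_ tC ->]] := wp_span hu m; elim: t tC => [|x t IH] tC.
    exists 0; rewrite big_nil; exact: (linear0 psiL).
  have [|h hE] := IH; first by move=> y yt; apply: tC; rewrite inE yt orbT.
  have /sC xs : C x.2 by apply: tC; rewrite mem_head.
  pose i := Ordinal (etrans (index_mem x.2 s) xs : (index x.2 s < n)%N).
  exists ([ffun j => if j == i then theta' x.1 else 0] + h).
  rewrite big_cons -hE -[psi _]/(psiL _) linearD; congr (_ + _).
  rewrite /= /psi (bigD1 i) //= ffunE eqxx thK' big1 ?addr0.
    by rewrite (tnth_nth x.2) /= nth_index.
  by move=> j /negbTE ji; rewrite ffunE ji th0 wp0.
have [psi' psiK'] := choice surj.
have psiK : cancel psi psi' by move=> h; apply: inj; exact: psiK'.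
have lin' : linear psi' := can2_linear (f := psiL) psiK psiK'.
have [N [v2r v2rl v2rb]] : exists N, exists2 v2r : {ffun 'I_n -> W} -> 'rV[K]_N,
    linear v2r & bijective v2r.
  exists (dim {ffun 'I_n -> W}), v2r.
    by move=> c x y; rewrite linearP.
  exists r2v; [exact: v2rK|].
  exact: r2vK.
exists N; constructor; exists (v2r \o psi').
  by move=> c x y /=; rewrite lin' v2rl.
by apply: bij_comp => //; exists psi.
Qed.

End WeightedPathModule.

(** * Path modules and their twists as weighted path modules *)

Section PathModuleWeighted.
Variables (L : fieldType) (E : graph) (C : set (anypath E)).
Hypothesis hC : path_closed C.

Lemma mcoeff_bvec k p q (Cp : C p) (Cq : `[< C q >]) :
  (k *: bvec L C p : {malg L[path_basis C]})@_(exist _ q Cq : path_basis C) =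
  k * (p == q)%:R.
Proof.
have Cp' : `[< C p >] by apply/asboolP.
by rewrite (bvecE L Cp') mcoeffZ mcoeffU.
Qed.

Lemma bvec_scale (k : L) (b : path_basis C) :
  << k *g b >> = k *: bvec L C (val b) :> path_space L C.
Proof.
case: b => p Cp; rewrite (bvecE L Cp); apply/malgP => b.
rewrite mcoeffZ [in RHS]mcoeffU mulr_natr.
exact: mcoeffU.
Qed.

Lemma path_module_weighted :
  @weighted_paths L L idfun E C (fun=> 1) (path_module L hC)
    (fun k p => k *: bvec L C p).
Proof.
split=> [k h p|c k p|m|s us sC s0 x xs|v k p Cp|e k p Cp sp|e k p Cp].
- exact: scalerDl.
- by rewrite scalerA.
- exists [seq ((m : {malg L[path_basis C]})@_b, val b)
         | b : path_basis C <- msupp (m : {malg L[path_basis C]})]; split.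
  + by rewrite -map_comp map_inj_uniq ?fset_uniq // => b b' /= /val_inj.
  + by move=> x /mapP[b _ ->] /=; exact/asboolP/(valP b).
  + rewrite big_map [LHS]monalgE; apply: eq_bigr => b _; exact: bvec_scale.
- have Cx : `[< C x.2 >] by apply/asboolP/sC.
  have := congr1 (fun m : {malg L[path_basis C]} => m@_(exist _ x.2 Cx : path_basis C)) s0.
  rewrite mcoeff0 raddf_sum big_seq.
  rewrite (eq_bigr (fun y => y.1 * (y.2 == x.2)%:R)); last first.
    by move=> y /sC Cy; exact: mcoeff_bvec.
  rewrite -big_seq (bigD1_seq x) //=; last exact: map_uniq us.
  rewrite eqxx mulr1 big_seq_cond big1 ?addr0 // => y /andP[ys yx].
  case: eqP => [yx2|_]; last by rewrite mulr0.
  by rewrite (uniq_map_inj us ys xs yx2) eqxx in yx.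
- rewrite linearZ /= /vact path_act_vtx //; case: eqP => // _.
  by rewrite scaler0.
- by rewrite mul1r linearZ; congr (k *: _); exact: path_act_edge.
- rewrite linearZ /= /gact path_act_ghost //; case: eqP => _; last by rewrite scaler0.
  by rewrite invr1 mul1r.
Qed.

Variables (K : fieldType) (iota : {rmorphism K -> L}) (a : edge E -> L).
Hypothesis ha : forall e, a e != 0.

Definition twisted_module : numodule (lpa K E) :=
  restrict_module iota (gauge_module ha (path_module L hC)).

Lemma twist_edge e :
  gauge a (base_change iota (lpa_of K (Edg e))) = a e *: lpa_of L (Edg e).
Proof.
rewrite /base_change lpa_twist_edge; last by move=> _; exact: oner_neq0.
by rewrite scale1r /gauge lpa_twist_edge.
Qed.

Lemma twist_ghost e :
  gauge a (base_change iota (lpa_of K (Gst e))) = (a e)^-1 *: lpa_of L (Gst e).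
Proof.
rewrite /base_change lpa_twist_ghost; last by move=> _; exact: oner_neq0.
by rewrite invr1 scale1r /gauge lpa_twist_ghost.
Qed.

Lemma twisted_module_weighted :
  @weighted_paths K L iota E C a twisted_module (fun k p => k *: bvec L C p).
Proof.
have hu := path_module_weighted.
split=> [k h p|c k p|m|s us sC s0 x xs|v k p Cp|e k p Cp sp|e k p Cp].
- exact: (wpD hu k h p).
- exact: (esym (scalerA (iota c) k (bvec L C p))).
- exact: (wp_span hu m).
- exact: (wp_free hu us sC s0 xs).
- rewrite -(wp_vact hu v k Cp).
  rewrite -[LHS]/(mact (gauge a (base_change iota (lpa_of K (Vtx v))))
    (k *: bvec L C p : path_module L hC)).
  rewrite /base_change lpa_twist_vertex /gauge ?lpa_twist_vertex //.
  by move=> _; exact: oner_neq0.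
- have h := wp_eact hu (a e * k) Cp sp; rewrite mul1r /= in h; rewrite -{}h.
  rewrite -[LHS]/(mact (gauge a (base_change iota (lpa_of K (Edg e))))
    (k *: bvec L C p : path_module L hC)).
  by rewrite twist_edge actZl -actZr scalerA.
- have h := wp_gact hu e ((a e)^-1 * k) Cp; rewrite invr1 mul1r in h; rewrite -{}h.
  rewrite -[LHS]/(mact (gauge a (base_change iota (lpa_of K (Gst e))))
    (k *: bvec L C p : path_module L hC)).
  by rewrite twist_ghost actZl -actZr scalerA.
Qed.

End PathModuleWeighted.

(** * The module of a sink *)

Section SinkModule.
Variables (K : fieldType) (E : graph) (x : sink E).

Definition sink_vector (k : K) (p : anypath E) : sink_module K x :=
  k *: bvec K (sink_class x) p.

Lemma sink_module_weighted :
  @weighted_paths K K idfun E (sink_class x) (fun=> 1) (sink_module K x) sink_vector.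
Proof. exact: path_module_weighted. Qed.

Definition sink_path : anypath E := FinPath (x : vertex E) [::].

Lemma sink_class_path : sink_class x sink_path.
Proof. by exists (@FPath _ (x : vertex E) [::] isT). Qed.

Lemma sink_module_simple : simple_module (sink_module K x).
Proof.
have one0 (e : edge E) : (1 : K) != 0 by exact: oner_neq0.
apply: (wp_simple (sink_class_closed x) one0 sink_module_weighted sink_class_path).
- by move=> p Cp sp; have [] := sink_class_base Cp (@sinkP _ x) sp.
- move=> p /sink_class_prepend[l [wl el pl]]; exists l; split=> //.
move=> S k h [_ _ SZ _] k0 Sk.
have -> : sink_vector h sink_path = (h / k) *: sink_vector k sink_path.
  by rewrite /sink_vector scalerA divfK.
exact: SZ.
Qed.

Lemma sink_module_fd : row_finite E -> maximal_sink x ->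
  finitely_many_predecessors (x : vertex E) -> finite_dimensional (sink_module K x).
Proof.
move=> hE xmax fP.
apply: (wp_finite_dimensional sink_module_weighted (W := K^o) (theta := id)) => //.
  by exists id.
exact: finite_sink_class.
Qed.

End SinkModule.

(** * The module of a maximal cycle and an irreducible polynomial *)

Section CycleModule.
Variables (K : fieldType) (E : graph) (c : gcycle E) (f : {poly K}).
Hypotheses (hf : monic_irreducible_poly f) (hX : f != 'X).
Local Notation L := {poly %/ f with hf}.
Local Notation C := (inf_class (cycle_inf c)).

Definition cycle_vector (k : L) (p : anypath E) : cycle_module c hf hX :=
  k *: bvec L C p.

Lemma cycle_module_weighted :
  @weighted_paths K L (in_alg L) E C (cycle_scalars c hf) (cycle_module c hf hX)
    cycle_vector.
Proof. exact: twisted_module_weighted. Qed.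

(** Only the first edge of [c] has a weight other than [1]; it occurs once in [c], and a rotation
    permutes the edges. *)
Lemma cycle_weight d : rotation_of c d ->
  walk_weight (cycle_scalars c hf) (cycle_edges d) = 'qX.
Proof.
move=> [i dE]; rewrite /walk_weight dE.
have /permPl /(perm_big _) -> := perm_rot i (cycle_edges c).
rewrite big_cons {1}/cycle_scalars eqxx big_seq big1 => [|e ec]; first exact: mulr1.
rewrite /cycle_scalars ifN //; apply: contraL ec => /eqP ->.
apply/negP => fc; have /= /andP[/negP nf _] := cycle_uniq c.
by apply: nf; rewrite map_f.
Qed.

Lemma horner_qX (g : {poly K}) : (map_poly (in_alg L) g).['qX] = in_qpoly f g :> L.
Proof.
elim/poly_ind: g => [|g k IH].
  by rewrite rmorph0 horner0 rmorph0.
rewrite rmorphD rmorphM /= map_polyX map_polyC hornerMXaddC IH.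
rewrite [in RHS]rmorphD rmorphM /=; congr (_ + _).
by rewrite -alg_polyC linearZ rmorph1.
Qed.

Hypothesis cmax : maximal_cycle c.

Section Rotation.
Variable d : gcycle E.
Hypothesis cd : rotation_of c d.

Lemma cycle_class_inf : C (of_ipath (cycle_inf d)).
Proof. by rewrite -(inf_class_rot cd); exact: inf_class_refl. Qed.

Lemma cycle_edges_walk : is_walk (cycle_base d) (cycle_edges d).
Proof. exact: cycle_walk. Qed.

Lemma cycle_edges_end : walk_end (cycle_base d) (cycle_edges d) = cycle_base d.
Proof. exact: cycle_closed. Qed.

Lemma cycle_class_base_uniq p :
  C p -> asource p = asource (of_ipath (cycle_inf d)) -> p = of_ipath (cycle_inf d).
Proof. by rewrite asource_cycle_inf; exact: cycle_class_base. Qed.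

(** Formulated at the base of any rotation [d], so that the modules built from [c] and from [d] can
    be compared at one common vertex. *)
Lemma cycle_module_poly (g : {poly K}) k :
  poly_act (walk_act (M:=cycle_module c hf hX) (cycle_edges d)) g
    (cycle_vector k (of_ipath (cycle_inf d))) =
  cycle_vector ((in_qpoly f g : L) * k) (of_ipath (cycle_inf d)).
Proof.
rewrite (wp_poly (inf_class_closed _) cycle_module_weighted cycle_class_inf
  cycle_class_base_uniq _ _ cycle_edges_walk cycle_edges_end).
by rewrite (cycle_weight cd) horner_qX.
Qed.

Lemma cycle_module_eigen k :
  poly_act (walk_act (M:=cycle_module c hf hX) (cycle_edges d)) f
    (cycle_vector k (of_ipath (cycle_inf d))) = 0.
Proof.
rewrite cycle_module_poly.
suff -> : in_qpoly f f = 0 :> L by rewrite mul0r (wp0 cycle_module_weighted).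
by apply: val_inj; rewrite /= (mk_monicE hf) -Pdiv.IdomainMonic.modpE ?hf.2 // modpp.
Qed.

Lemma cycle_vertex k :
  vact (cycle_base d) (cycle_vector k (of_ipath (cycle_inf d))) =
  cycle_vector k (of_ipath (cycle_inf d)).
Proof. exact: (wp_vertex cycle_module_weighted _ cycle_class_inf). Qed.

Lemma cycle_vector_neq0 : cycle_vector 1 (of_ipath (cycle_inf d)) <> 0.
Proof.
by move/(wp_inj cycle_module_weighted cycle_class_inf)/eqP; rewrite oner_eq0.
Qed.

Lemma cycle_corner (m : cycle_module c hf hX) : vact (cycle_base d) m = m ->
  exists k, m = cycle_vector k (of_ipath (cycle_inf d)).
Proof.
move=> vm; apply: (wp_corner cycle_module_weighted cycle_class_base_uniq).
by rewrite asource_cycle_inf.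
Qed.

End Rotation.

Lemma rotation_of_refl : rotation_of c c.
Proof. by exists 0%N; rewrite rot0. Qed.

Lemma cycle_module_simple : simple_module (cycle_module c hf hX).
Proof.
have cc := rotation_of_refl.
apply: (wp_simple (inf_class_closed _) (cycle_scalars_neq0 c hf hX) cycle_module_weighted
  (cycle_class_inf cc)).
- exact: cycle_class_base_uniq.
- move=> p /cycle_class_prepend[l [wl el pl]]; exists l; split=> //.
move=> S k h subS k0 Sk.
(* The reduced representative of [h / k] is a polynomial in [t], so the quotient is realized by a
   polynomial in [c]. *)
have -> : cycle_vector h (of_ipath (cycle_inf c)) =
    poly_act (walk_act (M:=cycle_module c hf hX) (cycle_edges c)) (val (h / k))
      (cycle_vector k (of_ipath (cycle_inf c))).
  rewrite (cycle_module_poly cc).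
  have -> : in_qpoly f (val (h / k)) = h / k :> L.
    by apply: val_inj; exact: (in_qpoly_small (size_mk_monic _)).
  by rewrite (divfK k0).
exact: submodule_poly.
Qed.

Lemma cycle_module_fd : row_finite E -> finitely_many_predecessors (cycle_base c) ->
  finite_dimensional (cycle_module c hf hX).
Proof.
move=> hE fP.
apply: (wp_finite_dimensional cycle_module_weighted (W := L) (theta := id)).
- by move=> k x y; rewrite mulr_algl.
- by exists id.
- exact: finite_cycle_class.
Qed.

End CycleModule.

(** * The classification *)

Section Classification.
Variables (K : fieldType) (E : graph).

Lemma cycle_eigen_iso (M N : numodule (lpa K E)) (c : gcycle E) (f : {poly K}) (m : M)
    (n : N) : simple_module M -> simple_module N -> maximal_cycle c ->
  irreducible_poly f ->
  vact (cycle_base c) m = m -> m <> 0 -> poly_act (walk_act (M:=M) (cycle_edges c)) f m = 0 ->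
  vact (cycle_base c) n = n -> n <> 0 -> poly_act (walk_act (M:=N) (cycle_edges c)) f n = 0 ->
  module_iso M N.
Proof.
move=> simM simN cmax irrf vm m0 fm vn n0 fn.
have wc : is_walk (cycle_base c) (cycle_edges c) by exact: cycle_walk.
have ec : walk_end (cycle_base c) (cycle_edges c) = cycle_base c by exact: cycle_closed.
have ann g := poly_act_eq0 g irrf fm m0.
have ann' g := poly_act_eq0 g irrf fn n0.
have vpoly (P : numodule (lpa K E)) (x : P) g : vact (cycle_base c) x = x ->
    vact (cycle_base c) (poly_act (walk_act (cycle_edges c)) g x) =
    poly_act (walk_act (cycle_edges c)) g x.
  exact: vact_poly.
(* [h] is an inverse of [t] modulo [f]; [f] is not associate to ['X] because [c] acts
   injectively. *)
have [h hX] : exists h, f %| h * 'X - 1.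
  have : coprimep 'X f.
    rewrite coprimep_sym irreducible_poly_coprime //; apply/negP => fX.
    apply: m0; apply: (walk_act_inj wc); first by rewrite ec.
    by have /ann := fX; rewrite poly_actX.
  move=> /Bezout_eq1_coprimepP[[u w] /= uw]; exists u.
  by rewrite -uw opprD addNKr -mulNr dvdp_mull.
(* The annihilators of [m] and [n] both consist of the multiples of [f], so this relation is the
   graph of a bijection between the cyclic spans. *)
pose P (x : M) (y : N) := exists g, x = poly_act (walk_act (cycle_edges c)) g m /\
  y = poly_act (walk_act (cycle_edges c)) g n.
apply: (@simple_module_iso _ _ _ _ simM simN (cycle_base c) P).
- by exists 0; rewrite !poly_act0.
- move=> x y x' y' [g [-> ->]] [g' [-> ->]]; exists (g + g').
  by rewrite !poly_actD.
- by move=> k x y [g [-> ->]]; exists (k *: g); rewrite !poly_actZ.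
- by move=> x y [g [-> ->]]; split; exact: vpoly.
- by move=> y [g [/esym/ann/ann' gn ->]].
- by move=> x [g [-> /esym/ann'/ann gm]].
- by exists m, n; split=> //; exists 1; rewrite !poly_act1.
- move=> l x y wl el [g [-> ->]].
  have [k ->] := maximal_cycle_closed_walk cmax wl el.
  elim: k {wl el} => [|k [g' [gm gn]]]; first by exists g.
  by exists ('X * g'); rewrite !poly_actM !poly_actX /= !walk_act_cat gm gn.
- move=> e x y es [g [-> ->]].
  (* Modulo [f], [g] equals ['X * (h * g)]: the vector is [c] applied to another one, so the ghost
     of the first edge of [c] cancels that edge. *)
  have inv (Q : numodule (lpa K E)) (z : Q) : (forall g', f %| g' ->
      poly_act (walk_act (cycle_edges c)) g' z = 0) ->
      poly_act (walk_act (cycle_edges c)) g z =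
      walk_act (cycle_edges c) (poly_act (walk_act (cycle_edges c)) (h * g) z).
    move=> annz; rewrite -(poly_actX (walk_act (cycle_edges c))) -poly_actM.
    apply/eqP; rewrite -subr_eq0 -scaleN1r -poly_actZ -poly_actD annz //.
    have -> : g + -1 *: ('X * (h * g)) = - (g * (h * 'X - 1)).
      by rewrite scaleN1r mulrBr mulr1 opprB; congr (_ - _); rewrite mulrA mulrC ['X * h]mulrC.
    by rewrite dvdpNr dvdp_mull.
  rewrite (inv _ _ (fun g' => (ann g').2)) (inv _ _ (fun g' => (ann' g').2)).
  rewrite -[cycle_edges c]/(first_edge c :: other_edges c) /=.
  have [->|/eqP ne] := eqVneq e (first_edge c); last first.
    by rewrite !gact_eact_neq //; exact: Span0.
  have /andP[_ wo] := wc.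
  have eo : walk_end (rng (first_edge c)) (other_edges c) = cycle_base c by exact: ec.
  rewrite !gact_eact !(vact_walk wo) ?eo; try exact: vpoly.
  apply: (SpanW wo eo); by exists (h * g).
Qed.

Lemma sink_supports (x : sink E) : supports (sink_module K x) (x : vertex E).
Proof.
exists (sink_vector x (1 : K) (sink_path x)); split.
  exact: (wp_vertex (sink_module_weighted K x) _ (sink_class_path x)).
by move/(wp_inj (sink_module_weighted K x) (sink_class_path x))/eqP; rewrite oner_eq0.
Qed.

Section FiniteDimensionalSimple.
Variable M : numodule (lpa K E).
Hypotheses (hE : row_finite E) (fd : finite_dimensional M) (simM : simple_module M).

Lemma supports_predecessors v : supports M v -> finitely_many_predecessors v.
Proof.
by move=> sv; apply: sub_finite_set (finite_support fd) => u uv; exact: supports_reaches sv.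
Qed.

(* Holds because a cycle in the support has no exit into the support. *)
Lemma supports_on_cycle c v : reaches (cycle_base c) v -> supports M v ->
  exists2 f, f \in cycle_edges c & src f = v.
Proof.
move=> /reachesP[l [wl el]] sv.
have [f0 f0c f0b] : exists2 f, f \in cycle_edges c & src f = cycle_base c.
  by exists (first_edge c) => //; exact: mem_first_edge.
rewrite -f0b in wl el; elim: l f0 f0c wl el {f0b} => [|e l IH] f fc /=; first by exists f.
move=> /andP[/eqP ef wl] el.
have se : supports M (rng e) by apply: supports_reaches sv; apply/reachesP; exists l.
have fe := closed_walk_exit fd (cycle_walk c) (cycle_closed c) fc ef se.
have [g gc gf] := cycle_edge_next fc.
have {}el : walk_end (rng e) l = v by exact: el.
by rewrite fe -gf in wl el; exact: (IH g).
Qed.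

(** A cycle [c'] reaching [c] passes through the base of [c], since it has no exit into the support.
    Rotated to start there, it agrees with [c] edge by edge, because the edges of [c] end in the
    support. *)
Lemma supports_maximal_cycle c : supports M (cycle_base c) -> maximal_cycle c.
Proof.
move=> sc c' nrot c'c; apply: nrot.
have [f fc' fb] := supports_on_cycle c'c sc.
have [d [rd df]] := cycle_start_at fc'.
have sE : cycle_edges c = cycle_edges d.
  apply: cycle_inf_eq => k.
  have supp_edge k' : supports M (rng (cycle_inf c k')).
    apply: supports_reaches sc.
    exact: (cycle_edge_loop (cycle_inf_mem c k')).2.
  elim: k => [|k IH].
    apply: (closed_walk_exit fd (cycle_walk d) (cycle_closed d)) (supp_edge _).
      exact: cycle_inf_mem.
    by rewrite -[RHS]/(src (first_edge d)) df fb.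
  apply: (closed_walk_exit fd (cycle_walk d) (cycle_closed d)) (supp_edge _).
    exact: cycle_inf_mem.
  by rewrite -!iedgeP IH.
by apply: rotation_of_sym; case: rd => i dE; exists i; rewrite sE.
Qed.

(** The only walk starting at a sink is trivial, so the multiples of one pair of vectors already
    form an admissible relation. *)
Lemma sink_support_iso (x : sink E) : supports M (x : vertex E) ->
  [/\ maximal_sink x, finitely_many_predecessors (x : vertex E) &
      module_iso M (sink_module K x)].
Proof.
move=> sx; split; first 2 last.
- have [m [vm m0]] := sx; have [n [vn n0]] := sink_supports x.
  pose P (y : M) (z : sink_module K x) := exists k : K, y = k *: m /\ z = k *: n.
  apply: (@simple_module_iso _ _ _ _ simM (sink_module_simple K x) (x : vertex E) P).
  + by exists 0; rewrite !scale0r.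
  + by move=> y z y' z' [k [-> ->]] [k' [-> ->]]; exists (k + k'); rewrite !scalerDl.
  + by move=> h y z [k [-> ->]]; exists (h * k); rewrite !scalerA.
  + by move=> y z [k [-> ->]]; rewrite !linearZ /= vm vn.
  + move=> z [k [/esym/eqP km ->]]; move: km; rewrite scaler_eq0.
    by case/orP=> [/eqP ->|/eqP //]; rewrite scale0r.
  + move=> y [k [-> /esym/eqP kn]]; move: kn; rewrite scaler_eq0.
    by case/orP=> [/eqP ->|/eqP //]; rewrite scale0r.
  + by exists m, n; split=> //; exists 1; rewrite !scale1r.
  + move=> [|e l] y z //= /andP[/eqP ex _].
    by case: (@sinkP _ x e).
  + by move=> e y z ex; case: (@sinkP _ x e).
- move=> c cx; have [f _ fx] := supports_on_cycle cx sx.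
  by case: (@sinkP _ x f).
- exact: supports_predecessors.
Qed.

Lemma cycle_support_iso c : supports M (cycle_base c) ->
  exists (f : {poly K}) (hf : monic_irreducible_poly f) (hX : f != 'X),
    [/\ maximal_cycle c, finitely_many_predecessors (cycle_base c) &
        module_iso M (cycle_module c hf hX)].
Proof.
move=> sc; have cmax := supports_maximal_cycle sc.
have [f [m [[irrf monf hX vm m0] fm]]] :=
  closed_walk_eigen fd (cycle_walk c) (cycle_closed c) sc.
have hf : monic_irreducible_poly f by split.
exists f, hf, hX; split=> //; first exact: supports_predecessors.
have cc := rotation_of_refl c.
exact (cycle_eigen_iso simM (cycle_module_simple hf hX cmax) cmax irrf vm m0 fm
  (cycle_vertex hX cc (1 : {poly %/ f with hf})) (@cycle_vector_neq0 _ _ _ _ hf hX _ cc)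
  (cycle_module_eigen hX cmax cc 1)).
Qed.

End FiniteDimensionalSimple.

Section Transport.
Variables (M N : numodule (lpa K E)) (phi : {linear M -> N}).
Hypothesis phiA : forall (a : lpa K E) (m : M), phi (mact a m) = mact a (phi m).

Lemma iso_walk l m : phi (walk_act l m) = walk_act l (phi m).
Proof. by elim: l => //= e l <-; rewrite /eact phiA. Qed.

Lemma iso_poly l g m : phi (poly_act (walk_act (M:=M) l) g m) =
  poly_act (walk_act (M:=N) l) g (phi m).
Proof.
rewrite /poly_act linear_sum; apply: eq_bigr => i _; rewrite linearZ; congr (_ *: _).
by elim: (nat_of_ord i) => //= j <-; rewrite iso_walk.
Qed.

Lemma iso_vertex v m : injective phi -> vact v m = m -> m <> 0 ->
  vact v (phi m) = phi m /\ phi m <> 0.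
Proof.
move=> inj vm m0; split; first by rewrite /vact -phiA -/(vact _ _) vm.
by rewrite -(linear0 phi) => /inj.
Qed.

End Transport.

Lemma module_iso_supports (M N : numodule (lpa K E)) v :
  module_iso M N -> supports M v -> supports N v.
Proof.
move=> [phi [/bij_inj inj phiA]] [m [vm m0]]; exists (phi m).
exact: (iso_vertex phiA).
Qed.

Lemma module_iso_sym (M N : numodule (lpa K E)) : module_iso M N -> module_iso N M.
Proof.
move=> [phi [[psi phiK psiK] phiA]].
have lin : linear psi := can2_linear (f := phi) phiK psiK.
pose psiL := HB.pack psi (GRing.isLinear.Build K N M _ psi lin) : {linear N -> M}.
exists psiL; split; first by exists phi.
by move=> a n /=; rewrite -{1}(psiK n) -phiA phiK.
Qed.

(** The image of the base vector of [c] shows that the second module is supported there, so the base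
    of [c] reaches [d] and maximality applies. That image is killed by [f], and by [g] as is every
    vector at that vertex; [f] being irreducible, it divides [g]. *)
Lemma cycle_module_iso_dvdp (c d : gcycle E) (f g : {poly K})
    (hf : monic_irreducible_poly f) (hfX : f != 'X)
    (hg : monic_irreducible_poly g) (hgX : g != 'X) :
  maximal_cycle c -> maximal_cycle d ->
  module_iso (cycle_module c hf hfX) (cycle_module d hg hgX) ->
  rotation_of d c /\ f %| g.
Proof.
move=> cmax dmax [phi [/bij_inj inj phiA]].
have cc := rotation_of_refl c.
have [vn n0] := iso_vertex phiA inj (cycle_vertex hfX cc (1 : {poly %/ f with hf}))
  (@cycle_vector_neq0 _ _ _ _ hf hfX _ cc).
have dc : rotation_of d c.
  apply: (maximal_cycle_rotation dmax).
  have [|p [Cp <-]] := @wp_supports _ _ _ _ _ _ _ _ (cycle_module_weighted d hg hgX)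
    (cycle_base c); first by eexists; split; [exact: vn|exact: n0].
  by have [l [wl el _]] := cycle_class_prepend Cp; apply/reachesP; exists l.
split=> //; have [k nE] := cycle_corner dmax dc vn.
have fn := iso_poly phiA (cycle_edges c) f
  (cycle_vector c hfX (1 : {poly %/ f with hf}) (of_ipath (cycle_inf c))).
rewrite cycle_module_eigen // linear0 in fn.
apply/(poly_act_eq0 g hf.1 (esym fn) n0).
by rewrite nE; exact: cycle_module_eigen.
Qed.

End Classification.

Theorem corollary4p27 (K : fieldType) (E : graph) (hE : row_finite E) :
  (* every module of the list is finite-dimensional and simple *)
  (forall x : sink E, maximal_sink x -> finitely_many_predecessors (x : vertex E) ->
     finite_dimensional (sink_module K x) /\ simple_module (sink_module K x)) /\
  (forall (c : gcycle E) (f : {poly K}) (hf : monic_irreducible_poly f)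
      (hX : f != 'X),
     maximal_cycle c -> finitely_many_predecessors (cycle_base c) ->
     finite_dimensional (cycle_module c hf hX) /\
     simple_module (cycle_module c hf hX)) /\
  (* every finite-dimensional simple module is isomorphic to one of the list *)
  (forall M : numodule (lpa K E), finite_dimensional M -> simple_module M ->
     (exists x : sink E,
        [/\ maximal_sink x, finitely_many_predecessors (x : vertex E) &
            module_iso M (sink_module K x)]) \/
     (exists (c : gcycle E) (f : {poly K}) (hf : monic_irreducible_poly f)
        (hX : f != 'X),
        [/\ maximal_cycle c, finitely_many_predecessors (cycle_base c) &
            module_iso M (cycle_module c hf hX)])) /\
  (* the list has no repetition, a cycle and its rotations counting as one *)
  (forall x y : sink E, maximal_sink x -> maximal_sink y ->
     finitely_many_predecessors (x : vertex E) ->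
     finitely_many_predecessors (y : vertex E) ->
     module_iso (sink_module K x) (sink_module K y) -> x = y :> vertex E) /\
  (forall (x : sink E) (c : gcycle E) (f : {poly K})
      (hf : monic_irreducible_poly f) (hX : f != 'X),
     maximal_sink x -> finitely_many_predecessors (x : vertex E) ->
     maximal_cycle c -> finitely_many_predecessors (cycle_base c) ->
     ~ module_iso (sink_module K x) (cycle_module c hf hX)) /\
  (forall (c d : gcycle E) (f g : {poly K}) (hf : monic_irreducible_poly f)
      (hfX : f != 'X) (hg : monic_irreducible_poly g) (hgX : g != 'X),
     maximal_cycle c -> finitely_many_predecessors (cycle_base c) ->
     maximal_cycle d -> finitely_many_predecessors (cycle_base d) ->
     module_iso (cycle_module c hf hfX) (cycle_module d hg hgX) <->
       f = g /\ rotation_of c d).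

Proof.
have cycle_iso (c d : gcycle E) (f g : {poly K}) (hf : monic_irreducible_poly f)
    (hfX : f != 'X) (hg : monic_irreducible_poly g) (hgX : g != 'X) :
    maximal_cycle c -> maximal_cycle d -> f = g -> rotation_of c d ->
    module_iso (cycle_module c hf hfX) (cycle_module d hg hgX).
  move=> cmax dmax fg cd; subst g.
  (* Both modules are compared at the base of [c], which is a rotation of [d] as well. *)
  have [cc dc] := (rotation_of_refl c, rotation_of_sym cd).
  exact (cycle_eigen_iso (cycle_module_simple hf hfX cmax)
    (cycle_module_simple hg hgX dmax) cmax hf.1
    (cycle_vertex hfX cc (1 : {poly %/ f with hf})) (@cycle_vector_neq0 _ _ _ _ hf hfX _ cc)
    (cycle_module_eigen hfX cmax cc 1)
    (cycle_vertex hgX dc (1 : {poly %/ f with hg})) (@cycle_vector_neq0 _ _ _ _ hg hgX _ dc)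
    (cycle_module_eigen hgX dmax dc 1)).
split; last split; last split; last split; last split.
- by move=> x xmax fx; split; [exact: sink_module_fd|exact: sink_module_simple].
- by move=> c f hf hX cmax fc; split; [exact: cycle_module_fd|exact: cycle_module_simple].
- move=> M fd simM.
  have [[x [xs sx]]|nsink] := pselect (exists x, is_sink x /\ supports M x).
    left; exists (Sink xs).
    exact: (@sink_support_iso _ _ _ fd simM (Sink xs) sx).
  right; have [m m0] := simM.1.
  have [v vm] := vertex_component m0.
  have [|w sw ws|c sc] := @supports_cycle _ _ M fd v hE.
  + by exists (vact v m); rewrite vact_vact.
  + by apply: nsink; exists w.
  by exists c; exact: cycle_support_iso.
- move=> x y _ _ _ _ iso.
  have [p [Cp px]] := wp_supports (sink_module_weighted K y)
    (module_iso_supports iso (sink_supports K x)).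
  by have [] := sink_class_base Cp (@sinkP _ x) px.
- move=> x c f hf hX _ _ _ _ iso.
  have [p [Cp px]] := wp_supports (cycle_module_weighted c hf hX)
    (module_iso_supports iso (sink_supports K x)).
  (* A path of the class of [c^oo] is infinite, so its source emits an edge and is not a sink. *)
  by case/inf_classP: Cp px => y [-> _]; exact: (@sinkP _ x).
- move=> c d f g hf hfX hg hgX cmax _ dmax _; split=> [iso|[fg cd]]; last first.
    exact: cycle_iso.
  have [dc fg] := cycle_module_iso_dvdp cmax dmax iso.
  have [cd gf] := cycle_module_iso_dvdp dmax cmax (module_iso_sym iso).
  split=> //; apply/eqP; rewrite -eqp_monic ?hf.2 ?hg.2 //.
  by rewrite /eqp fg gf.
Qed.
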